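(* Let $f,g$ be convergent real power series in $(x,y)$ starting with terms of order at least two, and let $v$ be the real analytic vector field $$\frac{dx}{dt}=y+f(x,y),\qquad \frac{dy}{dt}=g(x,y).$$ Assume that $v$ has a non-singular formal integral. Then there is a real formal transformation which transforms $v$ into $$\frac{dx}{dt}=y+r^*(x),\qquad \frac{dy}{dt}=0,$$ where $r^*\equiv 0$, or $$r^*(x)=\epsilon x^\sigma+\sum_{j>\sigma,\ \sigma\nmid j} r_j^* x^j,$$ with $\sigma\ge 2$ an integer, $\epsilon=1$ for $\sigma$ even, and $\epsilon=\pm1$ for $\sigma$ odd. Furthermore, when $\sigma$ is even, all $r_j^*$ $(\sigma<j<2\sigma)$ are invariants; when $\sigma$ is odd, $\epsilon$ and the coefficients $r_j^*$ $(\sigma<j<2\sigma)$, of which the first non-zero coefficient of even order (if any) is normalized to be positive, are invariants.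
   Context: A (real) formal transformation is an invertible formal change of coordinates fixing the origin, given by formal power series in $(x,y)$ with real coefficients. A transformation $\varphi$ transforms $v$ into $\tilde v$ if $\tilde v=\varphi_*v$ (identity of formal power series). A non-singular formal integral of $v$ is a formal power series $H(x,y)$ such that $dH(0)\neq 0$ and $\langle v,\nabla H\rangle=(y+f)H_x+gH_y=0$. A quantity attached to the normal form is called an invariant if it does not depend on the choice of the normal form of the stated type (including, for $\sigma$ odd, the stated sign normalization) to which $v$ is brought by a real formal transformation; i.e. any two such normal forms obtained from the same $v$ have the same value of this quantity. *)

(* Defs.v *)
From HB Require Import structures.
From mathcomp Require Import all_boot all_order all_algebra.
From mathcomp Require Import all_classical all_reals all_analysis.
Set Implicit Arguments.
Unset Strict Implicit.
Unset Printing Implicit Defensive.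
Import Order.TTheory GRing.Theory Num.Theory.
Local Open Scope ring_scope.

(* [a i j] is the coefficient of x^i y^j. The library has pointwise ring
   operations on function types, which are not those of power series; the
   operations below are therefore given names of their own. *)
Definition fps2 (R : comNzRingType) : Type := nat -> nat -> R.

Section FormalSeries.
Variable R : comNzRingType.
Implicit Types (a b : fps2 R) (r : nat -> R).

Definition fps2_const (c : R) : fps2 R :=
  fun i j => if (i == 0%N) && (j == 0%N) then c else 0.
Definition fps2_x : fps2 R := fun i j => ((i == 1%N) && (j == 0%N))%:R.
Definition fps2_y : fps2 R := fun i j => ((i == 0%N) && (j == 1%N))%:R.

(* the series r(x), regarded as a series in (x, y) *)
Definition fps2_of_x r : fps2 R := fun i j => if j == 0%N then r i else 0.

Definition fps2_add a b : fps2 R := fun i j => a i j + b i j.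
Definition fps2_mul a b : fps2 R := fun i j =>
  \sum_(k < i.+1) \sum_(l < j.+1) a k l * b (i - k)%N (j - l)%N.
Definition fps2_exp a (n : nat) : fps2 R := iter n (fps2_mul a) (fps2_const 1).

Definition fps2_dx a : fps2 R := fun i j => a i.+1 j *+ i.+1.
Definition fps2_dy a : fps2 R := fun i j => a i j.+1 *+ j.+1.

Definition order_ge (n : nat) a : Prop :=
  forall i j : nat, (i + j < n)%N -> a i j = 0.

(* A pair of series, used both for vector fields and for maps. *)
Definition fpair : Type := (fps2 R * fps2 R)%type.

(* a(p.1, p.2). When p has no constant terms, p.1^k p.2^l has order at least
   k + l, so the terms with k > i + j or l > i + j do not contribute to the
   coefficient of x^i y^j and the truncated sum is the full one. This is only
   used for such p. *)
Definition fps2_comp a (p : fpair) : fps2 R := fun i j =>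
  \sum_(k < (i + j).+1) \sum_(l < (i + j).+1)
    a k l * fps2_mul (fps2_exp p.1 k) (fps2_exp p.2 l) i j.

Definition map_comp2 (p q : fpair) : fpair := (fps2_comp p.1 q, fps2_comp p.2 q).

Definition map_id2 : fpair := (fps2_x, fps2_y).

Definition fixes_origin (p : fpair) : Prop :=
  p.1 0%N 0%N = 0 /\ p.2 0%N 0%N = 0.

Definition formal_inverse (phi psi : fpair) : Prop :=
  [/\ fixes_origin phi, fixes_origin psi,
      map_comp2 phi psi = map_id2 & map_comp2 psi phi = map_id2].

Definition formal_transformation (phi : fpair) : Prop :=
  exists psi, formal_inverse phi psi.

(* <v, grad a> *)
Definition lie_derivative (v : fpair) a : fps2 R :=
  fps2_add (fps2_mul v.1 (fps2_dx a)) (fps2_mul v.2 (fps2_dy a)).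

(* phi_* v = (D phi . v) o phi^-1, with psi = phi^-1 *)
Definition pushforward (phi psi v : fpair) : fpair :=
  map_comp2 (lie_derivative v phi.1, lie_derivative v phi.2) psi.

Definition transforms (phi v w : fpair) : Prop :=
  exists2 psi, formal_inverse phi psi & w = pushforward phi psi v.

Definition nonsingular_formal_integral (v : fpair) (H : fps2 R) : Prop :=
  (fps2_dx H 0%N 0%N, fps2_dy H 0%N 0%N) <> (0, 0) /\
  lie_derivative v H = fps2_const 0.

(* dx/dt = y + f(x,y), dy/dt = g(x,y) *)
Definition nilpotent_field (f g : fps2 R) : fpair := (fps2_add fps2_y f, g).

(* dx/dt = y + r(x), dy/dt = 0 *)
Definition normal_field r : fpair :=
  nilpotent_field (fps2_of_x r) (fps2_const 0).

End FormalSeries.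

Arguments fpair R : clear implicits.

Definition convergent (R : realType) (a : fps2 R) : Prop :=
  exists2 rho : R, 0 < rho &
    summable [set: nat * nat]
      (fun p => (a p.1 p.2 * rho ^+ p.1 * rho ^+ p.2)%:E).

(* For sigma odd, x |-> -x, y |-> -y changes the sign of the coefficients of
   even order only; the last field fixes this choice by requiring the first
   non-zero coefficient of even order j, sigma < j < 2 sigma, to be positive. *)
Record normal_type (R : realType) (sigma : nat) (eps : R) (r : nat -> R)
    : Prop := NormalType {
  normal_sigma : (2 <= sigma)%N;
  normal_eps : eps = 1 \/ (odd sigma /\ eps = -1);
  normal_low : forall j, (j < sigma)%N -> r j = 0;
  normal_lead : r sigma = eps;
  normal_mult : forall j, (sigma < j)%N -> (sigma %| j)%N -> r j = 0;
  normal_sign : odd sigma ->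
    forall j, (sigma < j < sigma.*2)%N -> ~~ odd j -> r j != 0 ->
    (forall i, (sigma < i < j)%N -> ~~ odd i -> r i = 0) -> 0 < r j
}.

Definition normal_series (R : realType) (r : nat -> R) : Prop :=
  (forall j, r j = 0) \/ exists sigma eps, normal_type sigma eps r.

Definition normal_form_of (R : realType) (v : fpair R) (r : nat -> R) : Prop :=
  normal_series r /\
  exists2 phi, formal_transformation phi & transforms phi v (normal_field r).

(* Main.v *)
Require Import Defs.
From HB Require Import structures.
From mathcomp Require Import all_boot all_order all_algebra.
From mathcomp Require Import all_classical all_reals all_analysis.
From mathcomp Require Import zify ring.
Set Implicit Arguments.
Unset Strict Implicit.
Unset Printing Implicit Defensive.
Import Order.TTheory GRing.Theory Num.Theory.
Local Open Scope ring_scope.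

(** The first integral H, after an affine normalization of its value, can serve
    as the coordinate y: the map (x, H) is formally invertible and turns the field
    into F(x, y) d/dx with F = y + (order at least 2) ([straighten_integral]). A map (X, Y) with Y a series in y alone then takes
    F d/dx to the field attached to r exactly when the residual
    F X_x - Y - r(X) vanishes, so everything reduces to the equation
    F X_x = Y + r(X).

    If F(x, 0) = 0, then F = y u with u a unit, and X is a primitive of 1/u with
    respect to x ([transforms_to_zero]). Otherwise
    F(x, 0) = c x^s + (higher terms) with s >= 2 and c <> 0. Give x the weight 1
    and y the weight s, so that y + c x^s is the homogeneous leading part of F.
    Around X = a x, where c = eps a^(s-1), the residual has the linearization
    L(D) - dY - a^m x^m dr_m, with L(D) = (y + c x^s) D_x - s c x^(s-1) D
    ([residual_linearize]), up to terms of higher weight.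
    In each weight m > s, the image of L has codimension one and is complemented
    by x^m and, when m = s k, also by y^k ([homological_solvable]). Hence the
    residual can be removed one weight after the other, changing r only in
    degrees that s does not divide, and changing Y instead in the degrees that it
    divides; successive approximations converge ([normalization_exists]).
    For s odd, the rotation (x, y) -> (-x, -y) changes the sign of the
    coefficients of even degree and provides the sign normalization.

    For the invariants, compare two normal forms of the same field: some (X, Y)
    takes the field of r to that of r'. The second component of the conjugacy
    forces Y to be a series in y alone, and the leading terms at y = 0 give
    r_s = r'_s a^(s-1) with a the coefficient of x in X ([conj_c]). The same
    linearization, now read as a constraint, shows that X = a x + D with D of
    weight at least s: the coefficient of x^(p-1) y in L(D) is p times that of x^p
    in D, and nothing else in the equation contributes there ([conj_D_wt_ge]).
    Below degree 2 s the only possible contribution of D to the coefficient of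
    x^j is in degree 2 s - 1, where the two terms of L cancel, so
    a r_j = a^j r'_j ([conj_coef]). Over the reals a = 1, or s is odd and
    a = -1; in the second case the sign normalization makes all the even
    coefficients in the range vanish ([normal_form_invariant]). *)


(** * The ring of formal power series *)
Section SeriesRing.
Variable R : comNzRingType.
Implicit Types a b c : fps2 R.

Lemma fps2P a b : (forall i j, a i j = b i j) -> a = b.
Proof. by move=> e; apply: funext => i; apply: funext => j; apply: e. Qed.

Definition fps2_opp a : fps2 R := fun i j => - a i j.

(** The ring laws only involve finitely many coefficients at a time, and are
    inherited from polynomials in y over polynomials in x. *)
Definition truncation n a : {poly {poly R}} := \poly_(j < n) \poly_(i < n) a i j.

Lemma coef_truncation n a i j : (i < n)%N -> (j < n)%N -> (truncation n a)`_j`_i = a i j.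
Proof. by move=> lin ljn; rewrite coef_poly ljn coef_poly lin. Qed.

Lemma coef2M (p q : {poly {poly R}}) i j :
  (p * q)`_j`_i =
  \sum_(k < i.+1) \sum_(l < j.+1) p`_l`_k * q`_(j - l)`_(i - k).
Proof.
rewrite coefM coef_sum exchange_big; apply: eq_bigr => l _.
by rewrite coefM.
Qed.

Lemma fps2_mul_truncation n a b i j : (i < n)%N -> (j < n)%N ->
  fps2_mul a b i j = (truncation n a * truncation n b)`_j`_i.
Proof.
move=> lin ljn; rewrite coef2M; apply: eq_bigr => k _; apply: eq_bigr => l _.
have := ltn_ord k; have := ltn_ord l => hl hk.
by rewrite !coef_truncation //; lia.
Qed.

Fact fps2_addA : associative (@fps2_add R).
Proof. by move=> a b c; apply: fps2P => i j; apply: addrA. Qed.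
Fact fps2_addC : commutative (@fps2_add R).
Proof. by move=> a b; apply: fps2P => i j; apply: addrC. Qed.
Fact fps2_add0 : left_id (fps2_const 0) (@fps2_add R).
Proof.
by move=> a; apply: fps2P => i j; rewrite /fps2_add /fps2_const if_same add0r.
Qed.
Fact fps2_addN : left_inverse (fps2_const 0) fps2_opp (@fps2_add R).
Proof.
move=> a; apply: fps2P => i j.
by rewrite /fps2_add /fps2_opp /fps2_const if_same addNr.
Qed.

Fact fps2_mulC : commutative (@fps2_mul R).
Proof.
move=> a b; apply: fps2P => i j.
have [hi hj] : (i < (i + j).+1)%N /\ (j < (i + j).+1)%N by lia.
by rewrite (fps2_mul_truncation a b hi hj) (fps2_mul_truncation b a hi hj) mulrC.
Qed.

Fact fps2_mulA : associative (@fps2_mul R).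
Proof.
move=> a b c; apply: fps2P => i j; set n := (i + j).+1.
transitivity ((truncation n a * (truncation n b * truncation n c))`_j`_i).
  rewrite coef2M; apply: eq_bigr => k _; apply: eq_bigr => l _.
  have := ltn_ord k; have := ltn_ord l => hl hk.
  by rewrite (@fps2_mul_truncation n) ?coef_truncation //; lia.
rewrite mulrA coef2M; apply: eq_bigr => k _; apply: eq_bigr => l _.
have := ltn_ord k; have := ltn_ord l => hl hk.
by rewrite (@fps2_mul_truncation n) ?coef_truncation //; lia.
Qed.

Fact fps2_mulD : left_distributive (@fps2_mul R) (@fps2_add R).
Proof.
move=> a b c; apply: fps2P => i j; rewrite /fps2_add /fps2_mul -big_split.
apply: eq_bigr => k _; rewrite -big_split; apply: eq_bigr => l _.
exact: mulrDl.
Qed.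

Lemma fps2_constM (c : R) a i j : fps2_mul (fps2_const c) a i j = c * a i j.
Proof.
rewrite /fps2_mul big_ord_recl big_ord_recl big1 => [|l _]; last first.
  by rewrite /fps2_const andbF mul0r.
rewrite big1 => [|k _]; last by apply: big1 => l _; rewrite /fps2_const mul0r.
by rewrite !addr0 !subn0.
Qed.

Fact fps2_mul1 : left_id (fps2_const 1) (@fps2_mul R).
Proof. by move=> a; apply: fps2P => i j; rewrite fps2_constM mul1r. Qed.
Fact fps2_neq0 : fps2_const 1 <> fps2_const 0 :> fps2 R.
Proof.
move=> e; have := congr1 (fun a : fps2 R => a 0%N 0%N) e.
by rewrite /fps2_const /=; apply/eqP; exact: oner_neq0.
Qed.

HB.instance Definition _ := gen_eqMixin (fps2 R).
HB.instance Definition _ := gen_choiceMixin (fps2 R).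
HB.instance Definition _ := GRing.isZmodule.Build (fps2 R)
  fps2_addA fps2_addC fps2_add0 fps2_addN.
HB.instance Definition _ := GRing.Zmodule_isComNzRing.Build (fps2 R)
  fps2_mulA fps2_mulC fps2_mul1 fps2_mulD (introN eqP fps2_neq0).

End SeriesRing.

Section SeriesTheory.
Variable R : comNzRingType.
Implicit Types a b c : fps2 R.

Lemma coefD2 a b i j : (a + b) i j = a i j + b i j. Proof. by []. Qed.
Lemma coefN2 a i j : (- a) i j = - a i j. Proof. by []. Qed.
Lemma coefB2 a b i j : (a - b) i j = a i j - b i j. Proof. by []. Qed.
Lemma coefM2 a b i j : (a * b) i j =
  \sum_(k < i.+1) \sum_(l < j.+1) a k l * b (i - k)%N (j - l)%N.
Proof. by []. Qed.
Lemma coef02 i j : (0 : fps2 R) i j = 0. Proof. exact: if_same. Qed.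
Lemma coef12 i j : (1 : fps2 R) i j = ((i == 0%N) && (j == 0%N))%:R.
Proof. by rewrite -[1]/(fps2_const 1) /fps2_const; case: ifP. Qed.
Lemma coef2_sum I (s : seq I) (P : pred I) (F : I -> fps2 R) i j :
  (\sum_(k <- s | P k) F k) i j = \sum_(k <- s | P k) F k i j.
Proof. by elim/big_rec2: _ => [|k x y _ <-]; rewrite ?coef02. Qed.

Fact fps2_const_is_zmod_morphism : zmod_morphism (@fps2_const R).
Proof.
move=> x y; apply: fps2P => i j; rewrite coefB2 /fps2_const.
by case: ifP => // _; rewrite subr0.
Qed.
Fact fps2_const_is_monoid_morphism : monoid_morphism (@fps2_const R).
Proof.
split=> // x y; apply: fps2P => i j; rewrite [RHS]fps2_constM /fps2_const.
by case: ifP => // _; rewrite mulr0.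
Qed.
HB.instance Definition _ := GRing.isZmodMorphism.Build R (fps2 R)
  (@fps2_const R) fps2_const_is_zmod_morphism.
HB.instance Definition _ := GRing.isMonoidMorphism.Build R (fps2 R)
  (@fps2_const R) fps2_const_is_monoid_morphism.

Lemma coefC2 (x : R) a i j : (fps2_const x * a) i j = x * a i j.
Proof. exact: fps2_constM. Qed.
Lemma coefMn2 a n i j : (a *+ n) i j = a i j *+ n.
Proof. by elim: n => [|n IH]; [rewrite !mulr0n coef02 | rewrite !mulrS coefD2 IH]. Qed.

Lemma fps2_expE a n : fps2_exp a n = a ^+ n.
Proof. by elim: n => // n IH; rewrite exprS -IH. Qed.

Local Notation sx := (fps2_x R).
Local Notation sy := (fps2_y R).

Lemma coefXM2 a i j : (sx * a) i j = if i is i'.+1 then a i' j else 0.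
Proof.
rewrite coefM2; case: i => [|i].
  by rewrite big_ord1 big1 // => l _; rewrite /fps2_x mul0r.
rewrite big_ord_recl big1 => [|l _]; last by rewrite /fps2_x mul0r.
rewrite big_ord_recl big_ord_recl big1 => [|l _]; last first.
  by rewrite /fps2_x mul0r.
rewrite big1 => [|k _]; last by apply: big1 => l _; rewrite /fps2_x mul0r.
by rewrite add0r !addr0 /fps2_x /= mul1r subn0 subSS subn0.
Qed.

Lemma coefYM2 a i j : (sy * a) i j = if j is j'.+1 then a i j' else 0.
Proof.
rewrite coefM2 big_ord_recl [X in _ + X]big1 => [|k _]; last first.
  by apply: big1 => l _; rewrite /fps2_y mul0r.
rewrite addr0 subn0; case: j => [|j]; first by rewrite big_ord1 /fps2_y mul0r.
rewrite big_ord_recl big_ord_recl big1 => [|l _]; last first.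
  by rewrite /fps2_y mul0r.
by rewrite addr0 /fps2_y mul0r add0r mul1r /= subSS subn0.
Qed.

Lemma coefXnM2 n a i j :
  (sx ^+ n * a) i j = if (n <= i)%N then a (i - n)%N j else 0.
Proof.
elim: n i => [|n IH] [|i]; rewrite ?expr0 ?mul1r ?subn0 //;
  by rewrite exprS -mulrA coefXM2 // IH.
Qed.

Lemma coefYnM2 n a i j :
  (sy ^+ n * a) i j = if (n <= j)%N then a i (j - n)%N else 0.
Proof.
elim: n j => [|n IH] [|j]; rewrite ?expr0 ?mul1r ?subn0 //;
  by rewrite exprS -mulrA coefYM2 // IH.
Qed.

Definition mon k l : fps2 R := sx ^+ k * sy ^+ l.

Lemma coef_mon k l i j : mon k l i j = ((i == k) && (j == l))%:R.
Proof.
rewrite /mon coefXnM2 -[sy ^+ l]mulr1 coefYnM2.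
have ->: (1 : fps2 R) = fps2_const 1 by [].
rewrite /fps2_const !subn_eq0 (eqn_leq i k) (eqn_leq j l).
by case: (k <= i)%N; case: (l <= j)%N; case: (i <= k)%N; case: (j <= l)%N.
Qed.

(** The order of a series when x has weight 1 and y has weight [w]. Order in the
    usual sense is the case [w = 1]; the main argument uses [w = s], the order of
    vanishing of the field along y = 0. *)
Definition wt_ge (w n : nat) a := forall i j, (i + w * j < n)%N -> a i j = 0.

Lemma order_geE n a : order_ge n a <-> wt_ge 1 n a.
Proof. by split=> h i j lt; apply: h; rewrite ?mul1n // -[j]mul1n. Qed.

Lemma wt_ge_coef w n a i j : wt_ge w n a -> (i + w * j < n)%N -> a i j = 0.
Proof. exact. Qed.
Lemma wt_geW w m n a : (m <= n)%N -> wt_ge w n a -> wt_ge w m a.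
Proof. by move=> le h i j lt; apply: h; apply: leq_trans le. Qed.
Lemma wt_ge0 w n : wt_ge w n 0. Proof. by move=> i j _; apply: coef02. Qed.
Lemma wt_geD w n a b : wt_ge w n a -> wt_ge w n b -> wt_ge w n (a + b).
Proof. by move=> ha hb i j lt; rewrite coefD2 ha ?hb ?addr0. Qed.
Lemma wt_geN w n a : wt_ge w n a -> wt_ge w n (- a).
Proof. by move=> ha i j lt; rewrite coefN2 ha ?oppr0. Qed.
Lemma wt_geB w n a b : wt_ge w n a -> wt_ge w n b -> wt_ge w n (a - b).
Proof. by move=> ha hb; apply: wt_geD => //; apply: wt_geN. Qed.
Lemma wt_ge_sum w n I (s : seq I) (P : pred I) (F : I -> fps2 R) :
  (forall i, P i -> wt_ge w n (F i)) -> wt_ge w n (\sum_(k <- s | P k) F k).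
Proof.
by move=> h; elim/big_ind: _ => //; [apply: wt_ge0 | apply: wt_geD].
Qed.
Lemma wt_geM w m n a b : wt_ge w m a -> wt_ge w n b -> wt_ge w (m + n) (a * b).
Proof.
move=> ha hb i j lt; rewrite coefM2 big1 // => k _; rewrite big1 // => l _.
have := ltn_ord k; have := ltn_ord l => hl hk.
have [lt1|le1] := ltnP (k + w * l) m; first by rewrite ha ?mul0r.
by rewrite hb ?mulr0 // mulnBr; nia.
Qed.
Lemma wt_geMl w n a b : wt_ge w n a -> wt_ge w n (b * a).
Proof. by move=> h; rewrite -[n]add0n; apply: wt_geM. Qed.
Lemma wt_geMr w n a b : wt_ge w n a -> wt_ge w n (a * b).
Proof. by move=> h; rewrite mulrC; apply: wt_geMl. Qed.
Lemma wt_geX w m n a : wt_ge w m a -> wt_ge w (n * m) (a ^+ n).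
Proof.
move=> h; elim: n => // n IH; rewrite exprS mulSn; exact: wt_geM.
Qed.
Lemma wt_ge_x w : wt_ge w 1 sx.
Proof. by move=> [|i] [|j] //; lia. Qed.
Lemma wt_ge_y w : wt_ge w w sy.
Proof. by move=> [|i] [|[|j]] //; lia. Qed.
Lemma wt_ge_mon w k l n : (n <= k + w * l)%N -> wt_ge w n (mon k l).
Proof.
by move=> le i j lt; rewrite coef_mon; case: eqP => // ?; case: eqP => //; nia.
Qed.
Lemma wt_ge_dx w n a : wt_ge w n.+1 a -> wt_ge w n (fps2_dx a).
Proof. by move=> h i j lt; rewrite /fps2_dx h ?mul0rn. Qed.
Lemma wt_ge_dy w n a : wt_ge w (n + w) a -> wt_ge w n (fps2_dy a).
Proof. by move=> h i j lt; rewrite /fps2_dy h ?mul0rn //; lia. Qed.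
Lemma wt_ge_eq0 w a : (forall n, wt_ge w n a) -> a = 0.
Proof. by move=> h; apply: fps2P => i j; rewrite coef02 (h _ i j (ltnSn _)). Qed.

Lemma trunc_expand n a :
  wt_ge 1 n (a - \sum_(k < n) \sum_(l < n) fps2_const (a k l) * mon k l).
Proof.
move=> i j lt; have [hi hj] : (i < n)%N /\ (j < n)%N by lia.
rewrite coefB2 coef2_sum (bigD1 (Ordinal hi)) //= coef2_sum.
rewrite (bigD1 (Ordinal hj)) //= coefC2 coef_mon !eqxx mulr1.
rewrite big1 => [|l nl]; last first.
  rewrite coefC2 coef_mon /= eqxx; case: eqP => [e|]; last by rewrite mulr0.
  by case/eqP: nl; apply: val_inj.
rewrite big1 => [|k nk]; last first.
  rewrite coef2_sum big1 // => l _; rewrite coefC2 coef_mon.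
  by case: eqP => [e|_]; [case/eqP: nk; apply: val_inj | rewrite mulr0].
by rewrite !addr0 subrr.
Qed.

(** Continuity for the adic topology is recorded by a loss of order at most [d]:
    substitution loses nothing and a partial derivative loses one. *)
Record cont_linear (T : fps2 R -> fps2 R) : Prop := ContLinear {
  clD : forall a b, T (a + b) = T a + T b;
  clZ : forall x a, T (fps2_const x * a) = fps2_const x * T a;
  clW : exists d, forall n a, wt_ge 1 (n + d) a -> wt_ge 1 n (T a) }.

Lemma cont_linear0 T : cont_linear T -> T 0 = 0.
Proof.
by case=> _ h _; rewrite -[X in T X](mul0r 0) -[X in X * _](rmorph0 (@fps2_const R)) h rmorph0 mul0r.
Qed.

Lemma cont_linearB T a b : cont_linear T -> T (a - b) = T a - T b.
Proof. by move=> clT; apply/eqP; rewrite eq_sym subr_eq -(clD clT) subrK. Qed.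

Lemma cont_linear_sum T I (s : seq I) (P : pred I) F : cont_linear T ->
  T (\sum_(k <- s | P k) F k) = \sum_(k <- s | P k) T (F k).
Proof.
move=> clT; elim/big_rec2: _ => [|k x y _ <-]; first exact: cont_linear0.
exact: clD.
Qed.

(** Modulo any given order a series is a combination of monomials. The Leibniz
    rule, the multiplicativity and associativity of substitution and the chain
    rule are thereby reduced to x^k y^l. *)
Lemma cont_linear_ext T S : cont_linear T -> cont_linear S ->
  (forall k l, T (mon k l) = S (mon k l)) -> T =1 S.
Proof.
move=> clT clS e a; apply: subr0_eq; apply: (@wt_ge_eq0 1) => n.
have [d hd] := clW clT; have [d' hd'] := clW clS.
set N := (n + d + d')%N; set t := \sum_(k < N) \sum_(l < N) fps2_const (a k l) * mon k l.
have eTS : T t = S t.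
  rewrite !cont_linear_sum //; apply: eq_bigr => k _.
  by rewrite !cont_linear_sum //; apply: eq_bigr => l _; rewrite !clZ ?e.
have ea : a = t + (a - t) by rewrite addrC subrK.
have hw : wt_ge 1 N (a - t) by apply: trunc_expand.
rewrite ea (clD clT) (clD clS) eTS opprD addrACA subrr add0r; apply: wt_geB.
  by apply: hd; apply: wt_geW hw; lia.
by apply: hd'; apply: wt_geW hw; lia.
Qed.

Lemma cl_id : cont_linear id.
Proof. by split=> //; exists 0%N => n a; rewrite addn0. Qed.
Lemma cl_comp T S : cont_linear T -> cont_linear S -> cont_linear (T \o S).
Proof.
move=> [TD TZ [d Td]] [SD SZ [e Se]]; split=> [a b|x a|] /=.
- by rewrite SD TD.
- by rewrite SZ TZ.
- by exists (d + e)%N => n a h; apply: Td; apply: Se; rewrite -addnA.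
Qed.
Lemma cl_add T S : cont_linear T -> cont_linear S ->
  cont_linear (fun a => T a + S a).
Proof.
move=> [TD TZ [d Td]] [SD SZ [e Se]]; split=> [a b|x a|] /=.
- by rewrite SD TD addrACA.
- by rewrite SZ TZ mulrDr.
- exists (d + e)%N => n a h.
  by apply: wt_geD; [apply: Td|apply: Se]; apply: wt_geW h; lia.
Qed.
Lemma cl_mul b T : cont_linear T -> cont_linear (fun a => b * T a).
Proof.
move=> [TD TZ [d Td]]; split=> [a a'|x a|].
- by rewrite TD mulrDr.
- by rewrite TZ mulrCA.
- by exists d => n a h; apply: wt_geMl; apply: Td.
Qed.
Lemma cl_mulr b T : cont_linear T -> cont_linear (fun a => T a * b).
Proof.
move=> /(cl_mul b); rewrite [X in cont_linear X -> _](_ : _ = fun a => T a * b) //.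
by apply: funext => a; rewrite mulrC.
Qed.
Lemma cl_dx : cont_linear (@fps2_dx R).
Proof.
split=> [a b|x a|]; last by exists 1%N => n a; rewrite addn1 => /wt_ge_dx.
- by apply: fps2P => i j; rewrite /fps2_dx coefD2 mulrnDl.
- by apply: fps2P => i j; rewrite coefC2 /fps2_dx coefC2 mulrnAr.
Qed.
Lemma cl_dy : cont_linear (@fps2_dy R).
Proof.
split=> [a b|x a|]; last by exists 1%N => n a h; apply: wt_ge_dy.
- by apply: fps2P => i j; rewrite /fps2_dy coefD2 mulrnDl.
- by apply: fps2P => i j; rewrite coefC2 /fps2_dy coefC2 mulrnAr.
Qed.

Lemma monM k l k' l' : mon k l * mon k' l' = mon (k + k') (l + l').
Proof. by rewrite /mon !exprD mulrACA. Qed.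

Lemma dx_mon k l : fps2_dx (mon k l) = mon k.-1 l *+ k.
Proof.
apply: fps2P => i j; rewrite /fps2_dx coefMn2 !coef_mon.
by case: k => [|k] //=; rewrite ?mulr0n ?mul0rn // eqSS; case: eqP => [->|] //=; rewrite !mul0rn.
Qed.
Lemma dy_mon k l : fps2_dy (mon k l) = mon k l.-1 *+ l.
Proof.
apply: fps2P => i j; rewrite /fps2_dy coefMn2 !coef_mon.
case: l => [|l] //=; rewrite ?andbF ?mulr0n ?mul0rn // eqSS.
by case: (j =P l) => [->|] //=; rewrite andbF !mul0rn.
Qed.

Lemma dx_x : fps2_dx sx = 1.
Proof.
by have := dx_mon 1 0; rewrite /mon /= !expr0 expr1 mulr1n !mulr1.
Qed.

Lemma dxM a b : fps2_dx (a * b) = fps2_dx a * b + a * fps2_dx b.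
Proof.
move: a; apply: cont_linear_ext => [||k l].
- exact: cl_comp cl_dx (cl_mulr b cl_id).
- exact: cl_add (cl_mulr _ cl_dx) (cl_mulr _ cl_id).
move: b; apply: cont_linear_ext => [||k' l'].
- exact: (cl_comp cl_dx (cl_mul _ cl_id)).
- exact: cl_add (cl_mul _ cl_id) (cl_mul _ cl_dx).
rewrite monM !dx_mon mulrnAl mulrnAr !monM mulrnDr.
by case: k => [|k]; case: k' => [|k']; rewrite ?mulr0n ?addn0 ?add0n ?addnS.
Qed.
Lemma dyM a b : fps2_dy (a * b) = fps2_dy a * b + a * fps2_dy b.
Proof.
move: a; apply: cont_linear_ext => [||k l].
- exact: cl_comp cl_dy (cl_mulr b cl_id).
- exact: cl_add (cl_mulr _ cl_dy) (cl_mulr _ cl_id).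
move: b; apply: cont_linear_ext => [||k' l'].
- exact: (cl_comp cl_dy (cl_mul _ cl_id)).
- exact: cl_add (cl_mul _ cl_id) (cl_mul _ cl_dy).
rewrite monM !dy_mon mulrnAl mulrnAr !monM mulrnDr.
by case: l => [|l]; case: l' => [|l']; rewrite ?mulr0n ?addn0 ?add0n ?addnS.
Qed.

End SeriesTheory.

Arguments wt_geX {R w m} n {a} _ i j _.
Arguments wt_ge_x {R} w i j _.
Arguments wt_ge_y {R} w i j _.

Lemma wt_ge_subM (R : comNzRingType) w m n (a a' b b' : fps2 R) :
  wt_ge w m a -> wt_ge w n b' -> wt_ge w m.+1 (a - a') -> wt_ge w n.+1 (b - b') ->
  wt_ge w (m + n).+1 (a * b - a' * b').
Proof.
move=> ha hb' haa hbb.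
have -> : a * b - a' * b' = a * (b - b') + (a - a') * b' by ring.
by apply: wt_geD; [rewrite -addnS|rewrite -addSn]; apply: wt_geM.
Qed.

Lemma wt_ge_subX (R : comNzRingType) w m n (a a' : fps2 R) :
  wt_ge w m a -> wt_ge w m a' -> wt_ge w m.+1 (a - a') ->
  wt_ge w (n * m).+1 (a ^+ n - a' ^+ n).
Proof.
move=> ha ha' haa; elim: n => [|n IH]; first by rewrite subrr; apply: wt_ge0.
by rewrite !exprS mulSn; apply: wt_ge_subM => //; apply: wt_geX.
Qed.

Arguments wt_ge_subX {R w m} n {a a'} _ _ _ i j _.

(** * Substitution and the chain rule *)
Section Composition.
Variable R : comNzRingType.
Implicit Types (a b c : fps2 R) (p q s v : fpair R).
Local Notation sx := (fps2_x R).
Local Notation sy := (fps2_y R).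

Lemma fixes_wt_ge p : fixes_origin p -> wt_ge 1 1 p.1 /\ wt_ge 1 1 p.2.
Proof. by case=> h1 h2; split=> [] [|i] [|j]; rewrite ?mul1n ?addnS. Qed.

(** The truncation bound may be enlarged at will, which lets one compare
    coefficients of different series within a common finite sum. *)
Lemma fps2_compE N p a i j : fixes_origin p -> (i + j < N)%N ->
  fps2_comp a p i j =
  \sum_(k < N) \sum_(l < N) a k l * (p.1 ^+ k * p.2 ^+ l) i j.
Proof.
move=> /fixes_wt_ge[h1 h2] lt.
have h k l : (i + j < k + l)%N -> (p.1 ^+ k * p.2 ^+ l) i j = 0.
  move=> lkl; refine (wt_ge_coef (wt_geM (wt_geX k h1) (wt_geX l h2)) _).
  by rewrite mul1n !muln1.
rewrite /fps2_comp (big_ord_widen N (fun k => \sum_(l < (i + j).+1)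
  a k l * fps2_mul (fps2_exp p.1 k) (fps2_exp p.2 l) i j)) // big_mkcond.
apply: eq_bigr => k _; case: ltnP => hk; last first.
  by rewrite big1 // => l _; rewrite h ?mulr0 //; lia.
rewrite (big_ord_widen N (fun l => 
  a k l * fps2_mul (fps2_exp p.1 k) (fps2_exp p.2 l) i j)) // big_mkcond.
apply: eq_bigr => l _; case: ltnP => hl; first by rewrite !fps2_expE.
by rewrite h ?mulr0 //; lia.
Qed.

Lemma wt_ge_comp n a p : fixes_origin p -> wt_ge 1 n a -> wt_ge 1 n (fps2_comp a p).
Proof.
move=> fp ha i j lt; rewrite (fps2_compE a fp (ltnSn _)).
have [h1 h2] := fixes_wt_ge fp.
rewrite big1 // => k _; rewrite big1 // => l _.
have [lt1|le1] := ltnP (k + l) n; first by rewrite ha ?mul0r ?mul1n.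
by rewrite (wt_ge_coef (wt_geM (wt_geX k h1) (wt_geX l h2))) ?mulr0 //; lia.
Qed.

Lemma cl_fps2_comp p : fixes_origin p -> cont_linear (fun a => fps2_comp a p).
Proof.
move=> fp; split=> [a b|x a|].
- apply: fps2P => i j; rewrite coefD2 /fps2_comp -big_split.
  apply: eq_bigr => k _; rewrite -big_split; apply: eq_bigr => l _.
  exact: mulrDl.
- apply: fps2P => i j; rewrite coefC2 /fps2_comp mulr_sumr.
  apply: eq_bigr => k _; rewrite mulr_sumr; apply: eq_bigr => l _.
  by rewrite coefC2 mulrA.
- by exists 0%N => n a; rewrite addn0; apply: wt_ge_comp.
Qed.

Lemma fps2_comp_mon p k l : fixes_origin p ->
  fps2_comp (mon R k l) p = p.1 ^+ k * p.2 ^+ l.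
Proof.
move=> fp; apply: fps2P => i j.
have [hk hl] : (k < (i + j + k + l).+1 /\ l < (i + j + k + l).+1)%N by lia.
rewrite (fps2_compE _ fp (_ : i + j < (i + j + k + l).+1)%N); last by lia.
rewrite (bigD1 (Ordinal hk)) //= (bigD1 (Ordinal hl)) //=.
rewrite coef_mon !eqxx mul1r.
rewrite big1 => [|l' nl]; last first.
  rewrite coef_mon eqxx; case: eqP => [e|]; last by rewrite mul0r.
  by case/eqP: nl; apply: val_inj.
rewrite big1 => [|k' nk]; last first.
  rewrite big1 // => l' _; rewrite coef_mon.
  by case: eqP => [e|_]; [case/eqP: nk; apply: val_inj | rewrite mul0r].
by rewrite !addr0.
Qed.

Lemma fps2_compM a b p : fixes_origin p ->
  fps2_comp (a * b) p = fps2_comp a p * fps2_comp b p.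
Proof.
move=> fp; have clp := cl_fps2_comp fp.
move: a; apply: cont_linear_ext => [||k l].
- exact: cl_comp clp (cl_mulr b (cl_id R)).
- exact: cl_mulr.
move: b; apply: cont_linear_ext => [||k' l'].
- exact: cl_comp clp (cl_mul _ (cl_id R)).
- exact: cl_mul.
by rewrite monM !fps2_comp_mon // !exprD mulrACA.
Qed.

Lemma fps2_comp1 p : fixes_origin p -> fps2_comp 1 p = 1.
Proof.
move=> fp; have := fps2_comp_mon 0 0 fp.
by rewrite /mon !expr0 !mulr1.
Qed.

Lemma fps2_compX a n p : fixes_origin p -> fps2_comp (a ^+ n) p = fps2_comp a p ^+ n.
Proof.
move=> fp; elim: n => [|n IH]; first by rewrite !expr0 fps2_comp1.
by rewrite !exprS fps2_compM // IH.
Qed.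

Lemma fps2_comp_x p : fixes_origin p -> fps2_comp sx p = p.1.
Proof. by move=> fp; have := fps2_comp_mon 1 0 fp; rewrite /mon !expr0 !mulr1 !expr1. Qed.
Lemma fps2_comp_y p : fixes_origin p -> fps2_comp sy p = p.2.
Proof. by move=> fp; have := fps2_comp_mon 0 1 fp; rewrite /mon !expr0 !mul1r !expr1. Qed.

Lemma fixes_origin_comp p q : fixes_origin p -> fixes_origin q ->
  fixes_origin (map_comp2 p q).
Proof.
move=> /fixes_wt_ge[h1 h2] fq; split; exact: wt_ge_coef (wt_ge_comp fq (n := 1) _) _.
Qed.

Lemma fps2_compA a p q : fixes_origin p -> fixes_origin q ->
  fps2_comp (fps2_comp a p) q = fps2_comp a (map_comp2 p q).
Proof.
move=> fp fq; have fpq := fixes_origin_comp fp fq.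
move: a; apply: cont_linear_ext => [||k l].
- exact: cl_comp (cl_fps2_comp fq) (cl_fps2_comp fp).
- exact: cl_fps2_comp.
by rewrite !fps2_comp_mon // fps2_compM // !fps2_compX.
Qed.

Lemma fixes_origin_id : fixes_origin (map_id2 R).
Proof. by []. Qed.

Lemma fps2_comp_id a : fps2_comp a (map_id2 R) = a.
Proof.
move: a; apply: cont_linear_ext => [||k l].
- exact: (cl_fps2_comp fixes_origin_id).
- exact: cl_id.
by rewrite fps2_comp_mon.
Qed.

Lemma map_comp2A p q s : fixes_origin q -> fixes_origin s ->
  map_comp2 (map_comp2 p q) s = map_comp2 p (map_comp2 q s).
Proof. by move=> fq fs; rewrite /map_comp2 /= !fps2_compA. Qed.

Lemma map_comp2_idl p : fixes_origin p -> map_comp2 (map_id2 R) p = p.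
Proof. by move=> fp; rewrite /map_comp2 fps2_comp_x ?fps2_comp_y //; case: p fp. Qed.

Lemma map_comp2_idr p : map_comp2 p (map_id2 R) = p.
Proof. by rewrite /map_comp2 !fps2_comp_id; case: p. Qed.

Lemma lieE v a : lie_derivative v a = v.1 * fps2_dx a + v.2 * fps2_dy a.
Proof. by []. Qed.

Lemma cl_lie v : cont_linear (lie_derivative v).
Proof. exact: cl_add (cl_mul _ (cl_dx R)) (cl_mul _ (cl_dy R)). Qed.

Lemma lieM v a b :
  lie_derivative v (a * b) = lie_derivative v a * b + a * lie_derivative v b.
Proof. by rewrite !lieE dxM dyM; ring. Qed.

Lemma lie1 v : lie_derivative v 1 = 0.
Proof.
have := lieM v 1 1; rewrite !mulr1 mul1r => /eqP.
by rewrite -subr_eq0 opprD addNKr oppr_eq0 => /eqP.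
Qed.

Lemma lieC v (x : R) : lie_derivative v (fps2_const x) = 0.
Proof. by rewrite -[fps2_const x]mulr1 (clZ (cl_lie v)) lie1 mulr0. Qed.

Lemma lieX v a n : lie_derivative v (a ^+ n.+1) =
  a ^+ n * lie_derivative v a *+ n.+1.
Proof.
elim: n => [|n IH]; first by rewrite expr1 expr0 mul1r.
by rewrite exprS lieM IH [RHS]mulrS mulrnAr mulrA -exprS [_ * a ^+ n.+1]mulrC.
Qed.

Lemma lie_x v : lie_derivative v sx = v.1.
Proof.
have := dx_mon R 1 0; have := dy_mon R 1 0.
by rewrite lieE /mon !expr0 !expr1 !mulr1 mulr0n mulr1n => -> ->; rewrite mulr0 mulr1 addr0.
Qed.
Lemma lie_y v : lie_derivative v sy = v.2.
Proof.
have := dx_mon R 0 1; have := dy_mon R 0 1.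
by rewrite lieE /mon !expr0 !expr1 !mul1r mulr0n mulr1n => -> ->; rewrite mulr0 mulr1 add0r.
Qed.

Lemma lie_comp v a p : fixes_origin p -> lie_derivative v (fps2_comp a p) =
  lie_derivative v p.1 * fps2_comp (fps2_dx a) p +
  lie_derivative v p.2 * fps2_comp (fps2_dy a) p.
Proof.
move=> fp; have clp := cl_fps2_comp fp.
move: a; apply: cont_linear_ext => [||k l].
- exact: cl_comp (cl_lie v) clp.
- exact: cl_add (cl_mul _ (cl_comp clp (cl_dx R)))
                (cl_mul _ (cl_comp clp (cl_dy R))).
have cMn n b : fps2_comp (b *+ n) p = fps2_comp b p *+ n.
  by elim: n => [|n IH]; rewrite ?(cont_linear0 clp) // !mulrS (clD clp) IH.
rewrite dx_mon dy_mon !cMn !fps2_comp_mon // lieM.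
case: k => [|k]; case: l => [|l]; rewrite ?expr0 ?lieX ?lie1 /=; ring.
Qed.

(** A map tangent to the identity acts as the identity on leading forms; this is
    what makes substitution invertible by successive approximations. *)
Lemma wt_ge_comp_near_id n a p : fixes_origin p ->
  wt_ge 1 2 (p.1 - sx) -> wt_ge 1 2 (p.2 - sy) -> wt_ge 1 n a ->
  wt_ge 1 n.+1 (fps2_comp a p - a).
Proof.
move=> fp h1 h2 ha i j lt.
rewrite -[a in _ - a]fps2_comp_id coefB2 !(fps2_compE a _ (ltnSn (i + j))) // -sumrB.
rewrite big1 // => k _; rewrite -sumrB big1 // => l _.
have [lt1|le1] := ltnP (k + l) n; first by rewrite ha ?mul0r ?subrr ?mul1n.
rewrite -mulrBr; have [w1 w2] := fixes_wt_ge fp.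
rewrite -coefB2 (wt_ge_coef (wt_ge_subM (wt_geX k w1) (wt_geX l (wt_ge_y 1))
  (wt_ge_subX k w1 (wt_ge_x 1) h1)
  (wt_ge_subX l w2 (wt_ge_y 1) h2))) ?mulr0 // !muln1; lia.
Qed.

End Composition.

(** * Formal inverses and conjugacy *)

(** The limit exists because the coefficient of index [i] is settled once
    [wt i < m]. Indexing by an arbitrary type [I] allows several series to be
    corrected simultaneously, each with its own weight shift. *)
Lemma successive_approximation (I V : Type) (wt : I -> nat)
    (P : nat -> (I -> V) -> Prop) (m0 : nat) (s0 : I -> V) :
  P m0 s0 ->
  (forall m s, (m0 <= m)%N -> P m s -> exists2 s',
     (forall i, (wt i < m)%N -> s' i = s i) & P m.+1 s') ->
  exists s, forall m, (m0 <= m)%N -> exists2 s',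
     (forall i, (wt i < m)%N -> s i = s' i) & P m s'.
Proof.
move=> P0 step.
have /choice[F hF] (ms : nat * (I -> V)) : exists s', (m0 <= ms.1)%N ->
    P ms.1 ms.2 ->
    (forall i, (wt i < ms.1)%N -> s' i = ms.2 i) /\ P ms.1.+1 s'.
  case: ms => m s /=; have [[le h]|n] := pselect ((m0 <= m)%N /\ P m s).
    by have [s' h1 h2] := step m s le h; exists s'.
  by exists s => le h; case: n.
pose sq := fix sq n := if n is n'.+1 then F ((m0 + n')%N, sq n') else s0.
have sqP n : P (m0 + n)%N (sq n).
  elim: n => [|n IH]; first by rewrite addn0.
  by rewrite addnS; apply: (hF ((m0 + n)%N, sq n) _ IH).2; apply: leq_addr.
have sq_stable n d i : (wt i < m0 + n)%N -> sq (n + d)%N i = sq n i.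
  move=> lt; elim: d => [|d IH]; first by rewrite addn0.
  rewrite addnS -IH.
  apply: (hF ((m0 + (n + d))%N, sq (n + d)%N) _ (sqP _)).1; first exact: leq_addr.
  by rewrite addnA; apply: leq_trans lt _; apply: leq_addr.
exists (fun i => sq (wt i).+1 i) => m le; exists (sq (m - m0)%N); last first.
  by rewrite -[in P m](subnKC le); apply: sqP.
move=> i lt; have lt1 : (wt i < m0 + (wt i).+1)%N by lia.
have lt2 : (wt i < m0 + (m - m0))%N by lia.
by rewrite -(sq_stable _ (m - m0)%N _ lt1) -(sq_stable _ (wt i).+1 _ lt2) addnC.
Qed.

Section Inverse.
Variable R : comNzRingType.
Implicit Types (a b c : fps2 R) (p q phi psi v w : fpair R).
Local Notation sx := (fps2_x R).
Local Notation sy := (fps2_y R).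
Local Notation C := (@fps2_const R).

(** The linear part is a homothety. Being of this form is stable under inversion,
    with a scalar for only parameter, and all the normalizing maps have it. *)
Definition near_homothety (x : R) p : Prop :=
  wt_ge 1 2 (p.1 - C x * sx) /\ wt_ge 1 2 (p.2 - C x * sy).

Lemma near_homothety_fixes x p : near_homothety x p -> fixes_origin p.
Proof.
case=> h1 h2; split.
  have := h1 0%N 0%N isT; rewrite coefB2 coefC2 /fps2_x /= mulr0 subr0; exact.
have := h2 0%N 0%N isT; rewrite coefB2 coefC2 /fps2_y /= mulr0 subr0; exact.
Qed.

(** At each stage the error [e] is pulled back by the inverse homothety; the
    composite with [p] is tangent to the identity, so the new error has higher
    order. The initial guess [d0] controls the low-order part of the solution. *)
Lemma comp_surjective x y p c d0 m0 : y * x = 1 -> near_homothety x p ->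
  wt_ge 1 m0 (c - fps2_comp d0 p) ->
  exists2 d, wt_ge 1 m0 (d - d0) & fps2_comp d p = c.
Proof.
move=> yx hp h0; have fp := near_homothety_fixes hp.
have clp := cl_fps2_comp fp.
pose series (s : nat * nat -> R) : fps2 R := fun i j => s (i, j).
pose P m s := wt_ge 1 m (c - fps2_comp (series s) p) /\
  wt_ge 1 m0 (series s - d0).
have [|m s le [hm hm0]|s hs] := @successive_approximation _ _
    (fun i => i.1 + 1 * i.2)%N P m0 (fun i => d0 i.1 i.2).
- by split=> //; rewrite [series _](_ : _ = d0) ?subrr //; apply: wt_ge0.
- pose e := c - fps2_comp (series s) p.
  pose q : fpair R := (C y * sx, C y * sy).
  have fq : fixes_origin q by split; rewrite /q /= coefC2 /fps2_x /fps2_y mulr0.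
  have he : wt_ge 1 m (fps2_comp e q) by apply: wt_ge_comp.
  pose d := series s + fps2_comp e q.
  exists (fun i => d i.1 i.2).
    by move=> [i j] lt; rewrite /d coefD2 he ?addr0.
  split; rewrite [series _](_ : _ = d) // /d; last first.
    by rewrite addrAC; apply: wt_geD => //; apply: wt_geW he.
  rewrite (clD clp) opprD addrA -/e fps2_compA //.
  rewrite -opprB; apply: wt_geN.
  have yE a b : C y * (a - C x * b) = C y * a - b.
    by rewrite mulrBr mulrA -rmorphM /= yx rmorph1 mul1r.
  apply: wt_ge_comp_near_id => //; first exact: fixes_origin_comp.
    by rewrite /= (clZ clp) fps2_comp_x // -yE; apply: wt_geMl; case: hp.
  by rewrite /= (clZ clp) fps2_comp_y // -yE; apply: wt_geMl; case: hp.
exists (series s).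
  have [s' h' [_ P']] := hs m0 (leqnn _); move=> i j lt.
  by rewrite coefB2 /series h' //; apply: P'.
apply/esym/subr0_eq; apply: (@wt_ge_eq0 _ 1) => n.
have [s' h' [P' _]] := hs (maxn n m0) (leq_maxr _ _).
apply: (wt_geW (leq_maxl n m0)).
have -> : c - fps2_comp (series s) p = (c - fps2_comp (series s') p) -
    (fps2_comp (series s) p - fps2_comp (series s') p) by ring.
apply: wt_geB => //; have -> : series s = series s' + (series s - series s').
  by rewrite addrC subrK.
rewrite (clD clp) [_ + fps2_comp _ _]addrC addrK; apply: wt_ge_comp => //.
by move=> i j lt; rewrite coefB2 /series h' ?subrr.
Qed.

Lemma left_inverse_exists x y p : y * x = 1 -> near_homothety x p ->
  exists2 q, near_homothety y q & map_comp2 q p = map_id2 R.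
Proof.
move=> yx hp; have fp := near_homothety_fixes hp; have clp := cl_fps2_comp fp.
have yE a b : b - C y * a = - (C y * (a - C x * b)).
  by rewrite mulrBr mulrA -rmorphM /= yx rmorph1 mul1r opprB.
have [|d1 h1 e1] := @comp_surjective x y p sx (C y * sx) 2 yx hp.
  rewrite (clZ clp) fps2_comp_x // yE.
  by apply: wt_geN; apply: wt_geMl; case: hp.
have [|d2 h2 e2] := @comp_surjective x y p sy (C y * sy) 2 yx hp.
  rewrite (clZ clp) fps2_comp_y // yE.
  by apply: wt_geN; apply: wt_geMl; case: hp.
by exists (d1, d2) => //; rewrite /map_comp2 e1 e2.
Qed.

(** A left inverse is again tangent to a homothety, hence has itself a left
    inverse, which must be the original map. *)
Lemma near_homothety_inverse x y p : y * x = 1 -> near_homothety x p ->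
  exists2 q, near_homothety y q & formal_inverse p q.
Proof.
move=> yx hp; have fp := near_homothety_fixes hp.
have [q hq qp] := left_inverse_exists yx hp.
have fq := near_homothety_fixes hq.
have xy : x * y = 1 by rewrite mulrC.
have [p' hp' p'q] := left_inverse_exists xy hq.
have fp' := near_homothety_fixes hp'.
exists q => //; split=> //.
have <- : p' = p; last by [].
by rewrite -[p']map_comp2_idr -qp -map_comp2A // p'q map_comp2_idl.
Qed.

(** The conjugacy relation multiplied out: once [phi] is known to be invertible,
    the inverse disappears from the equation to be solved. *)
Lemma pushforwardP phi psi v w : formal_inverse phi psi ->
  w = Defs.pushforward phi psi v <->
  lie_derivative v phi.1 = fps2_comp w.1 phi /\
  lie_derivative v phi.2 = fps2_comp w.2 phi.
Proof.
move=> [fphi fpsi e1 e2]; split=> [->|[h1 h2]].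
  by rewrite /Defs.pushforward /= !fps2_compA // e2 !fps2_comp_id.
by rewrite /Defs.pushforward /map_comp2 /= h1 h2 !fps2_compA // e1 !fps2_comp_id; case: w {h1 h2}.
Qed.

Lemma formal_inverse_sym phi psi :
  formal_inverse phi psi -> formal_inverse psi phi.
Proof. by case=> *; split. Qed.

Lemma formal_inverse_comp phi psi phi' psi' :
  formal_inverse phi psi -> formal_inverse phi' psi' ->
  formal_inverse (map_comp2 phi' phi) (map_comp2 psi psi').
Proof.
move=> [f1 f2 e1 e2] [f1' f2' e1' e2'].
split; try exact: fixes_origin_comp.
  rewrite map_comp2A //; last exact: fixes_origin_comp.
  by rewrite -[map_comp2 phi _]map_comp2A // e1 map_comp2_idl.
rewrite map_comp2A //; last exact: fixes_origin_comp.
by rewrite -[map_comp2 psi' _]map_comp2A // e2' map_comp2_idl.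
Qed.

Lemma lie_comp_push v w a p : fixes_origin p ->
  lie_derivative v p.1 = fps2_comp w.1 p ->
  lie_derivative v p.2 = fps2_comp w.2 p ->
  lie_derivative v (fps2_comp a p) = fps2_comp (lie_derivative w a) p.
Proof.
move=> fp h1 h2; rewrite lie_comp // h1 h2 -!fps2_compM //.
by rewrite -(clD (cl_fps2_comp fp)).
Qed.

Lemma transforms_trans phi phi' v w u : transforms phi v w ->
  transforms phi' w u -> transforms (map_comp2 phi' phi) v u.
Proof.
move=> [psi inv /(pushforwardP v w inv)[h1 h2]].
move=> [psi' inv' /(pushforwardP w u inv')[h1' h2']].
have inv2 := formal_inverse_comp inv inv'.
exists (map_comp2 psi psi') => //; apply/pushforwardP => //.
have [fphi _ _ _] := inv; have [fphi' _ _ _] := inv'.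
by rewrite /= !(@lie_comp_push v w) // h1' h2' !fps2_compA.
Qed.

Lemma transforms_sym phi v w : transforms phi v w ->
  exists psi, transforms psi w v.
Proof.
move=> [psi inv /(pushforwardP v w inv)[h1 h2]].
have inv' := formal_inverse_sym inv.
exists psi, phi => //; apply/pushforwardP => //.
have [fphi fpsi e1 e2] := inv.
have e a : lie_derivative w a =
    fps2_comp (lie_derivative v (fps2_comp a phi)) psi.
  by rewrite (@lie_comp_push v w) // fps2_compA // e1 fps2_comp_id.
have [e21 e22] : fps2_comp psi.1 phi = sx /\ fps2_comp psi.2 phi = sy.
  by case: e2.
by rewrite !e e21 e22 lie_x lie_y.
Qed.

Lemma near_homothety_transforms x y p v w : y * x = 1 -> near_homothety x p ->
  lie_derivative v p.1 = fps2_comp w.1 p ->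
  lie_derivative v p.2 = fps2_comp w.2 p -> transforms p v w.
Proof.
move=> yx hp h1 h2; have [q _ inv] := near_homothety_inverse yx hp.
by exists q => //; apply/pushforwardP.
Qed.

Lemma transforms_formal_transformation phi v w :
  transforms phi v w -> formal_transformation phi.
Proof. by case=> psi inv _; exists psi. Qed.

End Inverse.

(** * Linearization of the conjugacy equation *)
Section Linearization.
Variable R : comNzRingType.
Implicit Types (a b D : fps2 R) (p : fpair R) (r : nat -> R).
Local Notation sx := (fps2_x R).
Local Notation sy := (fps2_y R).
Local Notation C := (@fps2_const R).

Lemma wt_ge_weaken w n a : (0 < w)%N -> wt_ge 1 n a -> wt_ge w n a.
Proof. by move=> w0 h i j lt; apply: h; nia. Qed.

Lemma fps2_comp_of_x w n r p : (0 < w)%N -> fixes_origin p ->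
  wt_ge w n (fps2_comp (fps2_of_x r) p - \sum_(k < n) C (r k) * p.1 ^+ k).
Proof.
move=> w0 fp; apply: wt_ge_weaken => // i j lt; rewrite mul1n in lt.
rewrite coefB2 (fps2_compE _ fp lt) coef2_sum -sumrB big1 // => k _.
rewrite (bigD1 (Ordinal (leq_ltn_trans (leq0n _) lt))) //= expr0 mulr1.
rewrite big1 => [|l nl]; first by rewrite addr0 coefC2 /fps2_of_x /= subrr.
rewrite /fps2_of_x; case: eqP => [e|]; last by rewrite mul0r.
by case/eqP: nl; apply: val_inj.
Qed.

(** Taylor expansion of the power function: the remainder is divisible by D^2,
    which gains one more unit of weight as D has weight at least 2. *)
Lemma wt_ge_subX_linear w d n a D : (1 < d)%N -> wt_ge w 1 a -> wt_ge w d D ->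
  wt_ge w (d + n).+1 ((a + D) ^+ n.+1 - a ^+ n.+1 - a ^+ n * D *+ n.+1).
Proof.
move=> d2 ha hD; have haD : wt_ge w 1 (a + D) by apply: wt_geD => //; apply: wt_geW hD; lia.
elim: n => [|n IH].
  have -> : (a + D) ^+ 1 - a ^+ 1 - a ^+ 0 * D *+ 1 = 0 by ring.
  exact: wt_ge0.
have -> : (a + D) ^+ n.+2 - a ^+ n.+2 - a ^+ n.+1 * D *+ n.+2 =
    (a + D) * ((a + D) ^+ n.+1 - a ^+ n.+1 - a ^+ n * D *+ n.+1) +
    (n.+1)%:R * (a ^+ n * (D * D)).
  rewrite !exprS; move: (a ^+ n) ((a + D) ^+ n) => A B; ring.
apply: wt_geD; first by rewrite addnS -add1n; apply: wt_geM.
apply: wt_geMl; apply: wt_geW (wt_geM (wt_geX n ha) (wt_geM hD hD)); lia.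
Qed.

Lemma wt_ge_subXD w d n a D : (1 < d)%N -> wt_ge w 1 a -> wt_ge w d D ->
  wt_ge w (d + n) ((a + D) ^+ n.+1 - a ^+ n.+1).
Proof.
move=> d2 ha hD.
rewrite -[X in wt_ge _ _ X](subrK (a ^+ n * D *+ n.+1)); apply: wt_geD.
  by apply: wt_geW (wt_ge_subX_linear (n := n) d2 ha hD).
rewrite -mulr_natl; apply: wt_geMl.
by apply: wt_geW (wt_geM (wt_geX n ha) hD); lia.
Qed.

Definition of_y (b : nat -> R) : fps2 R := fun i j => if i == 0%N then b j else 0.

(** Its vanishing says that [p] takes F d/dx to the field (y + r(x)) d/dx, when
    [p.2] does not depend on x. *)
Definition residual (F : fps2 R) p r : fps2 R :=
  F * fps2_dx p.1 - p.2 - fps2_comp (fps2_of_x r) p.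

Definition homological (s : nat) (c : R) D : fps2 R :=
  (sy + C c * sx ^+ s) * fps2_dx D - C c * sx ^+ s.-1 * D *+ s.

Lemma of_y0 : of_y (fun=> 0) = 0.
Proof. by apply: fps2P => i j; rewrite coef02 /of_y if_same. Qed.

Lemma homological0 s c : homological s c 0 = 0.
Proof.
by rewrite /homological (cont_linear0 (cl_dx R)) !mulr0 mul0rn subr0.
Qed.

Lemma wt_ge_homological s c n D : (0 < s)%N -> wt_ge s n.+1 D ->
  wt_ge s (s + n) (homological s c D).
Proof.
move=> s0 hD; apply: wt_geB.
  apply: wt_geM; last exact: wt_ge_dx.
  apply: wt_geD; first exact: wt_ge_y.
  by apply: wt_geMl; apply: wt_geW (wt_geX s (wt_ge_x s)); rewrite muln1.
rewrite -mulr_natl -mulrA; apply: wt_geMl; apply: wt_geMl.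
by apply: wt_geW (wt_geM (wt_geX s.-1 (wt_ge_x s)) hD); lia.
Qed.

(** Only the term of degree [s] of r responds to a change D of X at weight
    [m = d + s - 1]: a term of degree k > s responds at weight d + k - 1 > m. *)
Lemma fps2_comp_of_x_linearize s m d (a eps : R) p p' r r' :
  (0 < s < m)%N -> (d + s = m.+1)%N -> (1 < d)%N ->
  (forall j, (j < s)%N -> r j = 0) -> r s = eps ->
  (forall j, (j < m)%N -> r' j = r j) ->
  fixes_origin p -> fixes_origin p' ->
  wt_ge s 2 (p.1 - C a * sx) -> wt_ge s d (p'.1 - p.1) ->
  wt_ge s m.+1 (fps2_comp (fps2_of_x r') p' - fps2_comp (fps2_of_x r) p -
    (C (eps * a ^+ s.-1) * sx ^+ s.-1 * (p'.1 - p.1) *+ s +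
     C ((r' m - r m) * a ^+ m) * sx ^+ m)).
Proof.
move=> /andP[s0 sm] ds d2 r0 rs rr' fp fp' hX hD.
have ax1 : wt_ge s 1 (C a * sx) by apply: wt_geMl; apply: wt_ge_x.
have hX1 : wt_ge s 1 p.1.
  by rewrite -(subrK (C a * sx) p.1); apply: wt_geD => //; apply: wt_geW hX.
set D := p'.1 - p.1 in hD *; have eD : p'.1 = p.1 + D by rewrite addrC subrK.
have h' := fps2_comp_of_x (n := m.+1) r' s0 fp'; have h := fps2_comp_of_x (n := m.+1) r s0 fp.
set S' := \sum_(k < m.+1) C (r' k) * p'.1 ^+ k in h'.
set S := \sum_(k < m.+1) C (r k) * p.1 ^+ k in h.
set c' := fps2_comp _ p' in h' *; set c := fps2_comp _ p in h *.
set lin := (X in wt_ge _ _ (_ - X)).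
have -> : c' - c - lin = (c' - S') - (c - S) + (S' - S - lin) by ring.
apply: wt_geD; first exact: wt_geB.
(* The power of index [s] absorbs the part of [lin] that is linear in D, and the
   top power absorbs the rest. *)
have -> : S' - S - lin = \sum_(k < m) (C (r k) * (p'.1 ^+ k - p.1 ^+ k) -
      (C (eps * a ^+ s.-1) * sx ^+ s.-1 * D *+ s) *+ (k == s :> nat)) +
    (C (r m) * (p'.1 ^+ m - p.1 ^+ m) +
     C (r' m - r m) * (p'.1 ^+ m - (C a * sx) ^+ m)).
  rewrite sumrB [X in _ = _ - X + _](bigD1 (Ordinal sm)) //= eqxx mulr1n.
  rewrite [X in _ = _ - (_ + X) + _]big1 => [|k nk]; last first.
    by case: eqP => // e; case/eqP: nk; apply: val_inj.
  under [X in _ = X - _ + _]eq_bigr do rewrite mulrBr.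
  rewrite sumrB /S' /S /lin !big_ord_recr /=.
  under eq_bigr do rewrite rr' //.
  rewrite [C (_ * a ^+ m)]rmorphM exprMn rmorphXn rmorphB /=; ring.
have hpow k : wt_ge s (d + k) (p'.1 ^+ k.+1 - p.1 ^+ k.+1).
  by rewrite eD; apply: wt_ge_subXD.
apply: wt_geD; first apply: wt_ge_sum => k _.
- case: ltngtP => [lt|gt|ek].
  + by rewrite r0 // rmorph0 mul0r subr0; apply: wt_ge0.
  + rewrite mulr0n subr0; apply: wt_geMl.
    by case: (nat_of_ord k) gt => // k' gt; apply: wt_geW (hpow k'); lia.
  + rewrite ek rs mulr1n rmorphM /= -mulrA -mulrA -mulrnAr -mulrBr.
    apply: wt_geMl; rewrite rmorphXn /= mulrA -exprMn.
    have -> : p'.1 ^+ s - p.1 ^+ s - (C a * sx) ^+ s.-1 * D *+ s =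
        (p'.1 ^+ s - p.1 ^+ s - p.1 ^+ s.-1 * D *+ s) +
        (p.1 ^+ s.-1 - (C a * sx) ^+ s.-1) * D *+ s.
      by rewrite mulrBl mulrnBl addrA subrK.
    have es : s.-1.+1 = s by rewrite prednK.
    apply: wt_geD.
      have := wt_ge_subX_linear (n := s.-1) d2 hX1 hD.
      by rewrite es -eD => h1; apply: wt_geW h1; lia.
    rewrite -mulr_natl; apply: wt_geMl.
    have h1 := wt_geM (wt_ge_subX s.-1 hX1 ax1 hX) hD.
    by apply: wt_geW h1; lia.
apply: wt_geD; apply: wt_geMl.
  by case: m sm ds {rr' h' h S' S lin} => // m sm ds; apply: wt_geW (hpow m); lia.
rewrite -(subrKA (p.1 ^+ m)); apply: wt_geD.
  by case: m sm ds {rr' h' h S' S lin} => // m sm ds; apply: wt_geW (hpow m); lia.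
by apply: wt_geW (wt_ge_subX m hX1 ax1 hX); lia.
Qed.

Lemma residual_linearize s m d (a c eps : R) F p p' r r' :
  (0 < s < m)%N -> (d + s = m.+1)%N -> (1 < d)%N ->
  wt_ge s s.+1 (F - (sy + C c * sx ^+ s)) -> c = eps * a ^+ s.-1 ->
  (forall j, (j < s)%N -> r j = 0) -> r s = eps ->
  (forall j, (j < m)%N -> r' j = r j) ->
  fixes_origin p -> fixes_origin p' ->
  wt_ge s 2 (p.1 - C a * sx) -> wt_ge s d (p'.1 - p.1) ->
  wt_ge s m.+1 (residual F p' r' - residual F p r -
    (homological s c (p'.1 - p.1) - (p'.2 - p.2) -
     C ((r' m - r m) * a ^+ m) * sx ^+ m)).
Proof.
move=> sm ds d2 hF ec r0 rs rr' fp fp' hX hD.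
have h := fps2_comp_of_x_linearize sm ds d2 r0 rs rr' fp fp' hX hD.
have hF' : wt_ge s m.+1 ((F - (sy + C c * sx ^+ s)) * fps2_dx (p'.1 - p.1)).
  have -> : m.+1 = (s.+1 + d.-1)%N by lia.
  by apply: wt_geM => //; apply: wt_ge_dx; rewrite prednK //; lia.
have := wt_geB hF' h; rewrite /residual /homological -ec.
rewrite (cont_linearB _ _ (cl_dx R)).
congr wt_ge; ring.
Qed.

End Linearization.

(** * The homological equation *)
Section HomologicalEquation.
Variables (R : numFieldType) (s m d : nat) (c : R).
Hypotheses (s_gt1 : (1 < s)%N) (s_lt_m : (s < m)%N) (d_eq : (d + s = m.+1)%N).
Hypothesis c_neq0 : c != 0.
Implicit Types (a e D : fps2 R) (b : nat -> R).
Local Notation sx := (fps2_x R).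
Local Notation sy := (fps2_y R).
Local Notation C := (@fps2_const R).

Lemma homological_linear (z : R) D D' :
  homological s c (C z * D + D') = C z * homological s c D + homological s c D'.
Proof.
rewrite /homological (clD (cl_dx R)) (clZ (cl_dx R)).
by rewrite mulrDr mulrDr mulrnDl mulrBr; ring.
Qed.

Lemma homological_mon u j : homological s c (mon R u.+1 j) =
  C (u.+1%:R) * mon R u j.+1 + C (c * (u.+1%:R - s%:R)) * mon R (u + s) j.
Proof.
rewrite /homological dx_mon /=.
have -> : mon R u j.+1 = sy * mon R u j by rewrite /mon exprS; ring.
have -> : mon R (u + s) j = sx ^+ s * mon R u j by rewrite /mon exprD; ring.
have -> : C c * sx ^+ s.-1 * mon R u.+1 j = C c * (sx ^+ s * mon R u j).
  by rewrite -(prednK (ltnW s_gt1)) /= /mon !exprS; ring.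
rewrite !rmorphM rmorphB !rmorph_nat /=; ring.
Qed.

(** The constraints on [b] and [z] encode the shape of the normal form: in a
    weight divisible by [s] the obstruction is put into Y, in the others into r.
    The condition that D vanishes at x = 0 keeps X tangent to a homothety, since
    it excludes a term in y. *)
Definition solvable_mod e := exists D b (z : R), 
  [/\ wt_ge s d D, (forall j, D 0%N j = 0),
      (forall j, (s * j)%N <> m -> b j = 0), ((s %| m)%N -> z = 0) &
      wt_ge s m.+1 (homological s c D - of_y b - C z * sx ^+ m - e)].

Lemma solvable_mod_linear (z : R) e e' :
  solvable_mod e -> solvable_mod e' -> solvable_mod (C z * e + e').
Proof.
move=> [D [b [t [hD hD0 hb ht h]]]] [D' [b' [t' [hD' hD0' hb' ht' h']]]].
exists (C z * D + D'), (fun j => z * b j + b' j), (z * t + t'); split.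
- by apply: wt_geD => //; apply: wt_geMl.
- by move=> j; rewrite coefD2 coefC2 hD0 hD0' mulr0 addr0.
- by move=> j nj; rewrite hb // hb' // mulr0 addr0.
- by move=> sm; rewrite ht // ht' // mulr0 addr0.
have -> : of_y (fun j => z * b j + b' j) = C z * of_y b + of_y b'.
  apply: fps2P => i j; rewrite coefD2 coefC2 /of_y.
  by case: eqP; rewrite ?mulr0 ?addr0.
have := wt_geD (wt_geMl (C z) h) h'.
rewrite homological_linear rmorphD rmorphM /=; congr wt_ge; ring.
Qed.

Lemma solvable_mod_small e : wt_ge s m.+1 e -> solvable_mod e.
Proof.
move=> he; exists 0, (fun=> 0), 0; split=> //; first exact: wt_ge0.
  by move=> j; rewrite coef02.
by rewrite homological0 of_y0 rmorph0 mul0r !subr0 sub0r; apply: wt_geN.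
Qed.

Let q j := mon R (m - s * j) j.

Lemma solvable_mod_pure_x : ~~ (s %| m)%N -> solvable_mod (q 0).
Proof.
move=> ndv; exists 0, (fun=> 0), (-1); split=> //; first exact: wt_ge0.
- by move=> j; rewrite coef02.
- by move=> dv; rewrite dv in ndv.
rewrite homological0 of_y0 rmorphN1 mulN1r /q /mon muln0 subn0 expr0 mulr1 subr0 sub0r opprK subrr.
exact: wt_ge0.
Qed.

Lemma solvable_mod_pure_y k : m = (s * k)%N -> solvable_mod (q k).
Proof.
move=> mk; exists 0, (fun j => - (j == k)%:R), 0; split=> //; first exact: wt_ge0.
- by move=> j; rewrite coef02.
- by move=> j; rewrite mk; case: eqP => [->|]; rewrite ?oppr0.
rewrite homological0.
have -> : of_y (fun j => - (j == k)%:R) = - q k :> fps2 R.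
  apply: fps2P => i j; rewrite coefN2 /of_y /q coef_mon mk subnn.
  by case: eqP => //=; rewrite oppr0.
rewrite rmorph0 mul0r sub0r opprK subr0 subrr; exact: wt_ge0.
Qed.

(** The operator sends a monomial to a combination of two neighbours among the
    monomials [q] of weight [m], so modulo solvable series each neighbour
    determines the other, provided that its coefficient is not zero. *)
Lemma solvable_mod_relation j : (s * j.+1 <= m)%N ->
  solvable_mod (C ((m - s * j.+1).+1%:R) * q j.+1 +
             C (c * ((m - s * j.+1).+1%:R - s%:R)) * q j).
Proof.
move=> le; have [u mu] : exists u, m = (s * j.+1 + u)%N.
  by exists (m - s * j.+1)%N; rewrite subnKC.
have e1 : (m - s * j.+1 = u)%N by lia.
have e2 : (m - s * j = u + s)%N by rewrite mu mulnS; lia.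
exists (mon R u.+1 j), (fun=> 0), 0; split=> //.
- by apply: wt_ge_mon; move: d_eq; rewrite mu mulnS; lia.
- by move=> k; rewrite coef_mon.
rewrite homological_mon /q e1 e2.
rewrite of_y0.
rewrite rmorph0 mul0r !subr0 subrr; exact: wt_ge0.
Qed.

Lemma solvable_mod_cancel (x y : R) e e' : x != 0 ->
  solvable_mod (C x * e + C y * e') -> solvable_mod e' -> solvable_mod e.
Proof.
move=> x0 h he'.
have h1 := solvable_mod_linear (- y / x) he' (solvable_mod_small (@wt_ge0 _ _ _)).
have := solvable_mod_linear x^-1 h h1; congr solvable_mod.
rewrite addr0 mulrDr !mulrA -!rmorphM /= mulVf // rmorph1 mul1r -addrA -mulrDl.
by rewrite -rmorphD /= [_ / x]mulrC mulrN addrN rmorph0 mul0r addr0.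
Qed.

(** If [s] does not divide [m], one starts from the pure power of x and goes up:
    the coefficient of [q j.+1] in the relation is a positive integer. If [s]
    divides [m], that pure power is not available, and one goes down from the pure
    power of y: the coefficient of [q j] is [c] times an integer congruent to 1
    modulo [s]. *)
Lemma solvable_mod_mon j : (s * j <= m)%N -> solvable_mod (q j).
Proof.
have [dv|ndv] := boolP (s %| m)%N.
  have [k mk] : exists k, m = (s * k)%N.
    by exists (m %/ s)%N; rewrite mulnC divnK.
  have down i : (i <= k)%N -> solvable_mod (q (k - i)).
    elim: i => [|i IH] ik; first by rewrite subn0; apply: solvable_mod_pure_y.
    have ek : (k - i = (k - i.+1).+1)%N by lia.
    have rel := @solvable_mod_relation (k - i.+1).
    rewrite -ek in rel; rewrite [X in solvable_mod X]addrC in rel.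
    apply: solvable_mod_cancel (rel _) (IH _);
      [ | by rewrite mk leq_mul2l leq_subr orbT | lia].
    rewrite mulf_neq0 // subr_eq0 eqr_nat mk.
    rewrite -mulnBr (subKn (ltnW ik)); apply/eqP => e.
    by case: i e {IH ik ek rel} => [|i]; rewrite ?muln0 ?mulnS; lia.
  move=> le; have jk : (j <= k)%N by nia.
  by have := down (k - j)%N (leq_subr _ _); rewrite subKn.
elim: j => [|j IH] le; first exact: solvable_mod_pure_x.
apply: solvable_mod_cancel (solvable_mod_relation le) (IH _); last by lia.
by rewrite pnatr_eq0.
Qed.

Lemma homological_solvable e : wt_ge s m e -> solvable_mod e.
Proof.
move=> he; pose top := \sum_(j < (m %/ s).+1) C (e (m - s * j)%N j) * q j.
have s0 : (0 < s)%N by lia.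
have htop : solvable_mod top.
  rewrite /top; elim/big_rec: _ => [|j x _ IH].
    exact: solvable_mod_small (@wt_ge0 _ _ _).
  apply: solvable_mod_linear => //; apply: solvable_mod_mon.
  by rewrite mulnC -leq_divRL // -ltnS.
have hrest : wt_ge s m.+1 (e - top).
  move=> i j lt; rewrite coefB2 /top coef2_sum.
  have [lt'|ge] := ltnP (i + s * j) m.
    rewrite he // big1 ?subrr // => k _; rewrite coefC2 /q coef_mon.
    case: eqP => [ei|]; last by rewrite mulr0.
    case: eqP => [ej|]; last by rewrite mulr0.
    have := ltn_ord k; rewrite ltnS leq_divRL // mulnC => hk.
    by rewrite -ej in hk ei; lia.
  have ei : i = (m - s * j)%N by lia.
  have hj : (j < (m %/ s).+1)%N by rewrite ltnS leq_divRL // mulnC; lia.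
  rewrite (bigD1 (Ordinal hj)) //= big1 => [|k nk].
    by rewrite coefC2 /q coef_mon -ei !eqxx mulr1 addr0 subrr.
  rewrite coefC2 /q coef_mon; case: (j =P k :> nat) => [ej|].
    by case/eqP: nk; apply: val_inj.
  by rewrite andbF mulr0.
have := solvable_mod_linear 1 htop (solvable_mod_small hrest).
by rewrite rmorph1 mul1r addrC subrK.
Qed.

End HomologicalEquation.

(** * Normalization for an isolated zero on the x-axis *)
Section Normalization.
Variable R : numFieldType.
Implicit Types (F : fps2 R).
Local Notation sx := (fps2_x R).
Local Notation sy := (fps2_y R).
Local Notation C := (@fps2_const R).

Lemma wt_ge_of_y s n (b : nat -> R) :
  (forall j, (s * j < n)%N -> b j = 0) -> wt_ge s n (of_y b).
Proof.
by move=> h i j lt; rewrite /of_y; case: eqP => // i0; apply: h; lia.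
Qed.

Lemma of_yB (b b' : nat -> R) : of_y b - of_y b' = of_y (fun j => b j - b' j).
Proof.
by apply: fps2P => i j; rewrite coefB2 /of_y; case: eqP; rewrite ?subr0.
Qed.

(** All that is asked of a normalizing map (X, Y) and of its normal form, except
    the sign normalization; [b] lists the coefficients of Y. *)
Record normal_data (s : nat) (a eps : R) (X : fps2 R) (b r : nat -> R) : Prop :=
  NormalData {
  nd_x : wt_ge s 2 (X - C a * sx);
  nd_x0 : forall j, X 0%N j = 0;
  nd_y0 : b 0%N = 0;
  nd_y1 : b 1%N = a;
  nd_low : forall j, (j < s)%N -> r j = 0;
  nd_lead : r s = eps;
  nd_mult : forall j, (s < j)%N -> (s %| j)%N -> r j = 0 }.

(** The corrections given by the homological equation cancel the part of weight
    [m] of the residual. A weight [n] of D acts at weight [n + s - 1] of the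
    residual, whence the shift in the stability condition on X. *)
Lemma normalize_step s m (a c eps : R) F X b r : (1 < s < m)%N -> a != 0 -> c != 0 ->
  wt_ge s s.+1 (F - (sy + C c * sx ^+ s)) -> c = eps * a ^+ s.-1 ->
  normal_data s a eps X b r -> wt_ge s m (residual F (X, of_y b) r) ->
  exists X' b' r', [/\ normal_data s a eps X' b' r',
    forall i j, (i + s * j + s.-1 < m)%N -> X' i j = X i j,
    forall j, (s * j < m)%N -> b' j = b j,
    forall j, (j < m)%N -> r' j = r j &
    wt_ge s m.+1 (residual F (X', of_y b') r')].
Proof.
move=> /andP[s1 sm] a0 c0 hF ec nd hres; have [hX hX0 b0 b1 r0 rs rm] := nd.
pose d := (m.+1 - s)%N; have ds : (d + s = m.+1)%N by rewrite /d; lia.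
have d2 : (1 < d)%N by rewrite /d; lia.
have [D [b1' [z [hD hD0 hb hz h]]]] :=
  homological_solvable s1 sm ds c0 (wt_geN hres).
pose r' j := if j == m then r m + z / a ^+ m else r j.
exists (X + D), (fun j => b j + b1' j), r'.
have hb0 j : (s * j < m)%N -> b1' j = 0 by move=> lt; apply: hb; lia.
have hr' j : (j < m)%N -> r' j = r j.
  by rewrite /r'; case: eqP => // ->; rewrite ltnn.
have fp (X' : fps2 R) (b' : nat -> R) : (forall j, X' 0%N j = 0) -> b' 0%N = 0 -> fixes_origin (X', of_y b').
  by move=> h1 h2; split; rewrite /= ?h1 // /of_y h2.
have hX0' j : (X + D) 0%N j = 0 by rewrite coefD2 hX0 hD0 addr0.
split=> //.
- split=> //.
  + by rewrite addrAC; apply: wt_geD => //; apply: wt_geW hD.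
  + by rewrite b0 hb0 ?addr0 // muln0; lia.
  + by rewrite b1 hb0 ?addr0 // muln1.
  + by move=> j js; rewrite hr' ?r0 //; lia.
  + by rewrite hr' // rs.
  + move=> j js dv; rewrite /r'; case: eqP => [ej|_]; last exact: rm.
    by rewrite hz -?ej // mul0r addr0 rm.
- move=> i j lt; rewrite coefD2 (wt_ge_coef hD) ?addr0 //; lia.
- by move=> j lt; rewrite hb0 ?addr0.
have s0m : (0 < s < m)%N by lia.
have := @residual_linearize _ s m d a c eps F (X, of_y b)
  (X + D, of_y (fun j => b j + b1' j)) r r' s0m ds d2 hF ec r0 rs hr'.
rewrite /= of_yB [X + D]addrC addrK => /(_ _ _ hX hD) /=.
move=> /(_ (fp _ _ hX0 b0)).
have -> : (fun j => b j + b1' j - b j) = b1' by apply: funext => j; rewrite addrC addKr.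
have -> : (r' m - r m) * a ^+ m = z.
  by rewrite /r' eqxx addrC addKr divfK // expf_neq0.
move=> hlin; have {hlin} := wt_geD (hlin _) h; rewrite [D + X]addrC.
have -> : forall A B L Y Z : fps2 R, A - B - (L - Y - Z) + (L - Y - Z - - B) = A.
  by move=> A B L Y Z; ring.
by apply; apply: fp; rewrite // b0 hb0 ?addr0 // muln0; lia.
Qed.

(** The limit of the normalization steps has residual zero because the
    linearization, used between the limit and the m-th approximation, bounds
    the difference of their residuals. *)
Lemma normalization_exists s (a c eps : R) F : (1 < s)%N -> a != 0 -> c != 0 ->
  wt_ge s s.+1 (F - (sy + C c * sx ^+ s)) -> c = eps * a ^+ s.-1 ->
  exists X b r, normal_data s a eps X b r /\ residual F (X, of_y b) r = 0.
Proof.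
move=> s1 a0 c0 hF ec.
pose I := (nat * nat + nat + nat)%type.
(* The offset for X is that of [normalize_step]. *)
pose wt (i : I) := match i with
  | inl (inl (i, j)) => i + s * j + s.-1 | inl (inr j) => s * j | inr j => j end%N.
pose X_ (u : I -> R) : fps2 R := fun i j => u (inl (inl (i, j))).
pose b_ (u : I -> R) j := u (inl (inr j)).
pose r_ (u : I -> R) j := u (inr j).
pose P m u := normal_data s a eps (X_ u) (b_ u) (r_ u) /\
  wt_ge s m (residual F (X_ u, of_y (b_ u)) (r_ u)).
pose join X b r (i : I) : R := match i with
  | inl (inl (i, j)) => X i j | inl (inr j) => b j | inr j => r j end.
(* The starting point solves the equation at weight [s]. *)
pose X0 : fps2 R := C a * sx.
pose b0 j : R := if j == 1%N then a else 0.
pose r0 j : R := if j == s then eps else 0.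
have [||u hu] := @successive_approximation I R wt P s.+1 (join X0 b0 r0).
- have nd : normal_data s a eps X0 b0 r0.
    split=> //.
    + by rewrite subrr; apply: wt_ge0.
    + by move=> j; rewrite /X0 coefC2 /fps2_x /= mulr0.
    + by move=> j lt; rewrite /r0; case: eqP => // e; lia.
    + by rewrite /r0 eqxx.
    + by move=> j lt _; rewrite /r0; case: eqP => // e; lia.
  split; first by [].
  have fp : fixes_origin (X0, of_y b0).
    by split; rewrite //= /X0 coefC2 /fps2_x mulr0.
  have := fps2_comp_of_x (n := s.+1) r0 (ltnW s1) fp.
  rewrite big_ord_recr /= big1 => [|k _]; last first.
    by rewrite /r0 (ltn_eqF (ltn_ord k)) rmorph0 mul0r.
  have r0s : r0 s = eps by rewrite /r0 eqxx.
  rewrite add0r r0s => hr0.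
  have := wt_geB (wt_geMl (C a) hF) hr0; congr wt_ge.
  rewrite -[LHS]/(_ - _) -[residual _ _ _]/(F * fps2_dx X0 - of_y b0 -
    fps2_comp (fps2_of_x r0) (X0, of_y b0)).
  have -> : of_y b0 = C a * sy.
    apply: fps2P => i j; rewrite coefC2 /of_y /b0 /fps2_y.
    by case: (i == 0%N); case: (j == 1%N); rewrite /= ?mulr1n ?mulr0n ?mulr1 ?mulr0.
  have -> : fps2_dx X0 = C a.
    by rewrite /X0 (clZ (cl_dx R)) dx_x mulr1.
  rewrite exprMn -(prednK (ltnW s1)) [C a ^+ _.+1]exprS prednK ?(ltnW s1) //.
  rewrite ec rmorphM rmorphXn /=; ring.
- move=> m u le [nd hres].
  have [|X' [b' [r' [nd' h1 h2 h3 h4]]]] := normalize_step _ a0 c0 hF ec nd hres.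
    by lia.
  by exists (join X' b' r') => //; case=> [[[i j]|j]|j] /=; [apply: h1|apply: h2|apply: h3].
exists (X_ u), (b_ u), (r_ u).
have [u0 hu0 [[hX hX0 hy0 hy1 hlow hlead hmult] _]] := hu s.+1 (leqnn _).
have hXu i j : (i + s * j + s.-1 < s.+1)%N -> X_ u i j = X_ u0 i j.
  by move=> lt; apply: (hu0 (inl (inl (i, j)))).
have hbu j : (s * j < s.+1)%N -> b_ u j = b_ u0 j.
  by move=> lt; apply: (hu0 (inl (inr j))).
have hru j : (j < s.+1)%N -> r_ u j = r_ u0 j.
  by move=> lt; apply: (hu0 (inr j)).
have nd : normal_data s a eps (X_ u) (b_ u) (r_ u).
  split.
  - by move=> i j lt; rewrite coefB2 hXu; [exact: wt_ge_coef hX lt | lia].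
  - move=> j; have [|v hv [[_ h _ _ _ _ _] _]] := hu (s.+1 + (s * j + s))%N.
      exact: leq_addr.
    by rewrite -[RHS](h j); apply: (hv (inl (inl (0%N, j)))) => /=; lia.
  - by rewrite hbu // muln0.
  - by rewrite hbu // muln1.
  - by move=> j js; rewrite hru ?hlow //; lia.
  - by rewrite hru.
  - move=> j js dv; have [|v hv [[_ _ _ _ _ _ h] _]] := hu (s.+1 + j)%N.
      exact: leq_addr.
    by rewrite -[RHS](h j js dv); apply: (hv (inr j)) => /=; lia.
split=> //; apply: (@wt_ge_eq0 _ s) => n; pose m := (s.+1 + n)%N.
have [v hv [[vX vX0 vy0 vy1 vlow vlead vmult] hres]] := hu m (leq_addr _ _).
have [uX uX0 uy0 uy1 _ _ _] := nd.
have fpu : fixes_origin (X_ u, of_y (b_ u)) by split; [exact: uX0 | exact: uy0].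
have fpv : fixes_origin (X_ v, of_y (b_ v)) by split; [exact: vX0 | exact: vy0].
pose d := (m.+1 - s)%N.
have s0m : (0 < s < m)%N by rewrite /m; lia.
have ds : (d + s = m.+1)%N by rewrite /d /m; lia.
have d2 : (1 < d)%N by rewrite /d /m; lia.
have hD : wt_ge s d (X_ u - X_ v).
  move=> i j lt; rewrite coefB2 [X_ u i j](hv (inl (inl (i, j)))) ?subrr //=.
  by rewrite /d in lt; lia.
have hr j : (j < m)%N -> r_ u j = r_ v j by exact: (hv (inr j)).
have h := residual_linearize s0m ds d2 hF ec vlow vlead hr fpv fpu vX hD.
set lin := (X in wt_ge _ _ (_ - X)) in h.
have hlin : wt_ge s m lin.
  apply: wt_geB; first apply: wt_geB.
  - have -> : m = (s + d.-1)%N by rewrite /d /m; lia.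
    by apply: wt_ge_homological; rewrite ?prednK //; lia.
  - rewrite /= of_yB; apply: wt_ge_of_y => j lt.
    by rewrite [b_ u j](hv (inl (inr j))) ?subrr.
  - by apply: wt_geMl; apply: wt_geW (wt_geX m (wt_ge_x s)); rewrite muln1.
set e := residual _ _ _ in h *; set e' := residual _ _ _ in h hres.
have -> : e = (e - e' - lin) + (lin + e') by ring.
apply: (@wt_geW _ _ _ m); first by rewrite /m; lia.
by apply: wt_geD; [apply: wt_geW h | apply: wt_geD].
Qed.

End Normalization.

(** * Straightening the formal integral *)
Section Straightening.
Variable R : fieldType.
Implicit Types (F u z : fps2 R) (p : fpair R).
Local Notation sx := (fps2_x R).
Local Notation sy := (fps2_y R).
Local Notation C := (@fps2_const R).

(** The coefficient of y in the equation for H is H_x(0), so that only H_y(0) can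
    be non-zero, and H can replace y as a coordinate. *)
Lemma straighten_integral (f g H : fps2 R) : order_ge 2 f -> order_ge 2 g ->
  nonsingular_formal_integral (nilpotent_field f g) H ->
  exists phi F, transforms phi (nilpotent_field f g) (F, 0) /\
    wt_ge 1 2 (F - sy).
Proof.
move=> /order_geE hf /order_geE hg [nz hH]; set v := nilpotent_field f g in hH *.
have H10 : H 1%N 0%N = 0.
  have := congr1 (fun a : fps2 R => a 0%N 1%N) hH.
  rewrite lieE /v /nilpotent_field /= -[fps2_add _ _]/(sy + f) mulrDl.
  rewrite [fps2_const 0 _ _]/= coefD2 coefD2 coefYM2.
  rewrite (wt_ge_coef (wt_geMr _ hf)) // (wt_ge_coef (wt_geMr _ hg)) //.
  by rewrite !addr0 /fps2_dx mulr1n.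
have H01 : H 0%N 1%N != 0.
  by apply/eqP => e; apply: nz; rewrite /fps2_dx /fps2_dy H10 e !mul0rn.
(* The scaling makes the linear part of the new coordinate equal to y. *)
pose Y := C (H 0%N 1%N)^-1 * (H - C (H 0%N 0%N)).
have hp : near_homothety 1 (sx, Y).
  rewrite /near_homothety /= rmorph1 !mul1r subrr; split; first exact: wt_ge0.
  move=> i j; rewrite mul1n => lt; rewrite coefB2 /Y coefC2 coefB2.
  case: i lt => [|[|i]]; case: j => [|[|j]] // _; rewrite /fps2_const /fps2_y /=.
  - by rewrite subrr mulr0 subr0.
  - by rewrite subr0 mulVf // subrr.
  - by rewrite H10 !subr0 mulr0.
have [psi [hpsi1 hpsi2] inv] := near_homothety_inverse (mulr1 1) hp.
have [fphi fpsi _ _] := inv.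
exists (sx, Y), (fps2_comp (sy + f) psi); split.
  exists psi => //; rewrite /Defs.pushforward /map_comp2 /= lie_x.
  have -> : lie_derivative v Y = 0.
    have clv := cl_lie v; rewrite /Y (clZ clv) (cont_linearB _ _ clv) hH lieC.
    by rewrite subr0 mulr0.
  by rewrite (cont_linear0 (cl_fps2_comp fpsi)).
rewrite (clD (cl_fps2_comp fpsi)) fps2_comp_y // addrAC.
apply: wt_geD; last exact: wt_ge_comp.
by move: hpsi2; rewrite rmorph1 mul1r.
Qed.

(** Neumann iteration: replacing z by z + (1 - u z) multiplies the
    error 1 - u z by 1 - u. *)
Lemma unit_series_inverse u : u 0%N 0%N = 1 -> exists z, u * z = 1.
Proof.
move=> u1; have hu : wt_ge 1 1 (1 - u).
  move=> [|i] [|j] //; rewrite ?addnS // => _.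
  by rewrite coefB2 u1 coef12 subrr.
pose series (s : nat * nat -> R) : fps2 R := fun i j => s (i, j).
have [||z hz] := @successive_approximation _ _ (fun i => i.1 + 1 * i.2)%N
    (fun m s => wt_ge 1 m (1 - u * series s)) 0 (fun=> 0).
- by move=> i j.
- move=> m s _ hm; pose z := series s + (1 - u * series s).
  exists (fun i => z i.1 i.2).
    by move=> [i j] lt; rewrite /z coefD2 hm ?addr0.
  rewrite [series _](_ : _ = z) //.
  have -> : 1 - u * z = (1 - u) * (1 - u * series s) by rewrite /z; ring.
  exact: (wt_geM hu hm).
exists (series z); apply/esym/subr0_eq; apply: (@wt_ge_eq0 _ 1) => n.
have [s hs hn] := hz n (leq0n _).
have -> : 1 - u * series z = (1 - u * series s) - u * (series z - series s) by ring.
apply: wt_geB => //; apply: wt_geMl => i j lt.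
by rewrite coefB2 /series hs ?subrr.
Qed.

Lemma residual_transforms x y p F r : y * x = 1 -> near_homothety x p ->
  fps2_dx p.2 = 0 -> residual F p r = 0 -> transforms p (F, 0) (normal_field r).
Proof.
move=> yx hp hY /subr0_eq/eqP; rewrite subr_eq => /eqP hX.
have fp := near_homothety_fixes hp.
apply: (near_homothety_transforms yx hp); rewrite lieE /= mul0r addr0.
  rewrite hX -[fps2_add _ _]/(sy + fps2_of_x r) (clD (cl_fps2_comp fp)).
  by rewrite fps2_comp_y // addrC.
by rewrite hY mulr0 -[fps2_const 0]/(0 : fps2 R) (cont_linear0 (cl_fps2_comp fp)).
Qed.

Lemma fps2_comp_of_x_scale (x : R) p r : fixes_origin p -> p.1 = C x * sx ->
  fps2_comp (fps2_of_x r) p = fps2_of_x (fun k => r k * x ^+ k).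
Proof.
move=> fp e; apply: subr0_eq; apply: (@wt_ge_eq0 _ 1) => n.
have h := fps2_comp_of_x (w := 1) (n := n) r isT fp.
have := fps2_comp_of_x (w := 1) (n := n) (fun k => r k * x ^+ k) isT
  (fixes_origin_id R).
rewrite fps2_comp_id => /(wt_geB h); congr wt_ge.
have -> : \sum_(k < n) C (r k * x ^+ k) * (map_id2 R).1 ^+ k =
    \sum_(k < n) C (r k) * p.1 ^+ k.
  by apply: eq_bigr => k _; rewrite e exprMn rmorphM rmorphXn mulrA.
ring.
Qed.

End Straightening.

(** * The field vanishing along the x-axis *)
Section FlatCase.
Variable R : numFieldType.
Local Notation sx := (fps2_x R).
Local Notation sy := (fps2_y R).

Lemma transforms_to_zero (F : fps2 R) : wt_ge 1 2 (F - sy) ->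
  (forall i, F i 0%N = 0) ->
  exists phi, transforms phi (F, 0) (normal_field (fun=> 0)).
Proof.
move=> hF F0; pose u : fps2 R := fun i j => F i j.+1.
have Fu : F = sy * u.
  by apply: fps2P => i [|j]; rewrite coefYM2 ?F0.
have [|z uz] := @unit_series_inverse _ u.
  have := wt_ge_coef hF (_ : 0 + 1 * 1 < 2)%N; rewrite coefB2 => /(_ isT)/subr0_eq.
  exact.
have z1 : z 0%N 0%N = 1.
  have := congr1 (fun a : fps2 R => a 0%N 0%N) uz.
  rewrite coefM2 !big_ord1 /= subnn.
  have := wt_ge_coef hF (_ : 0 + 1 * 1 < 2)%N; rewrite coefB2 => /(_ isT)/subr0_eq.
  by rewrite /u => -> ; rewrite mul1r.
pose X : fps2 R := fun i j => if i is i'.+1 then z i' j / i%:R else 0.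
have dX : fps2_dx X = z.
  by apply: fps2P => i j; rewrite /fps2_dx /X -[LHS]mulr_natr divfK.
exists (X, sy); apply: (@residual_transforms _ 1 1); rewrite ?mulr1 //.
- rewrite /near_homothety /= rmorph1 !mul1r subrr; split; last exact: wt_ge0.
  move=> i j; rewrite mul1n coefB2.
  case: i => [|[|i]]; case: j => [|[|j]] // _; rewrite /X /fps2_x /= ?subrr //.
  by rewrite z1 divr1 subrr.
- have := dx_mon R 0 1; rewrite /mon expr0 mul1r expr1 mulr0n; exact.
rewrite /residual /= dX Fu -mulrA uz mulr1 subrr sub0r.
have -> : fps2_of_x (fun=> 0) = 0 :> fps2 R.
  by apply: fps2P => i j; rewrite coef02 /fps2_of_x if_same.
have fp : fixes_origin (X, sy) by [].
by rewrite (cont_linear0 (cl_fps2_comp fp)) oppr0.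
Qed.

End FlatCase.

(** * Constraints on a conjugacy between two normal fields *)
Section Uniqueness.
Variable R : numFieldType.
Implicit Types (r : nat -> R).
Local Notation sx := (fps2_x R).
Local Notation sy := (fps2_y R).
Local Notation C := (@fps2_const R).

Lemma wt_ge_of_x w n r : (forall k, (k < n)%N -> r k = 0) ->
  wt_ge w n (fps2_of_x r).
Proof.
by move=> h i j lt; rewrite /fps2_of_x; case: eqP => // j0; apply: h; lia.
Qed.

(** The lowest-order part of y + r(x) is y. *)
Lemma normal_field_regular r (G : fps2 R) : r 0%N = 0 -> r 1%N = 0 ->
  (sy + fps2_of_x r) * G = 0 -> G = 0.
Proof.
move=> r0 r1 h; apply: (@wt_ge_eq0 _ 1); elim=> [|n IH] // i j lt.
have := congr1 (fun a : fps2 R => a i j.+1) h.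
rewrite mulrDl coefD2 coefYM2 coef02.
rewrite (wt_ge_coef (wt_geM (wt_ge_of_x (w := 1) (n := 2) (r := r) _) IH)).
- by rewrite addr0.
- by case=> [|[|k]].
- lia.
Qed.

Section Conjugacy.
Variables (r r' : nat -> R) (phi : fpair R).
Hypothesis hphi : transforms phi (normal_field r) (normal_field r').
Hypotheses (r0 : r 0%N = 0) (r1 : r 1%N = 0).
Let F := sy + fps2_of_x r.
Let X := phi.1.
Let Y := phi.2.
Let a := X 1%N 0%N.

Lemma conj_fixes : fixes_origin phi.
Proof. by case: hphi => psi []. Qed.

Lemma conj_dxY : fps2_dx Y = 0.
Proof.
have [psi inv /(pushforwardP _ _ inv)[_ h]] := hphi.
apply: (normal_field_regular r0 r1); move: h.
rewrite lieE /= -[fps2_const 0]/(0 : fps2 R) mul0r addr0.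
by rewrite (cont_linear0 (cl_fps2_comp conj_fixes)).
Qed.

Lemma conj_Y i j : Y i.+1 j = 0.
Proof.
have := congr1 (fun b : fps2 R => b i j) conj_dxY.
by rewrite coef02 => /eqP; rewrite mulrn_eq0 => /eqP.
Qed.

Lemma conj_residual : residual F phi r' = 0.
Proof.
have [psi inv /(pushforwardP _ _ inv)[h _]] := hphi.
move: h; rewrite lieE /= -[fps2_const 0]/(0 : fps2 R) mul0r addr0 => h.
have e : F * fps2_dx X = fps2_comp (sy + fps2_of_x r') phi by [].
rewrite /residual e (clD (cl_fps2_comp conj_fixes)) (fps2_comp_y conj_fixes).
by rewrite addrAC addrK subrr.
Qed.

(** As Y_x = 0, the chain rule for the inverse map reads 1 = X_x times a
    series. *)
Lemma conj_a_neq0 : a != 0.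
Proof.
have [psi [fphi fpsi e1 e2] _] := hphi.
have [e _] : fps2_comp psi.1 phi = sx /\ fps2_comp psi.2 phi = sy by case: e2.
have := lie_comp (1, 0) psi.1 fphi; rewrite e lie_x !lieE /= !mul1r !mul0r !addr0.
rewrite conj_dxY mul0r addr0 => /(congr1 (fun b : fps2 R => b 0%N 0%N)).
rewrite coefM2 !big_ord1 coef12 /fps2_dx mulr1n => h.
by apply/eqP => a0; move/eqP: h; rewrite -/X -/a a0 mul0r oner_eq0.
Qed.

Lemma conj_X s : (1 < s)%N -> wt_ge s 2 (X - C a * sx).
Proof.
move=> s1 i j lt; rewrite coefB2 coefC2 /fps2_x.
case: j lt => [|j] lt; last by exfalso; nia.
case: i lt => [|[|i]] lt; last by exfalso; lia.
  by case: conj_fixes => h _; rewrite /X h mulr0 subr0.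
by rewrite mulr1 subrr.
Qed.

(** Comparison of the coefficients of x^s. Giving y the weight s + 1 removes
    every term that contains y from the comparison. *)
Lemma conj_lead s : (0 < s)%N -> (forall k, (k < s)%N -> r k = 0) ->
  (forall k, (k < s)%N -> r' k = 0) -> r s * a = r' s * a ^+ s.
Proof.
move=> s0 rl rl'; have fp := conj_fixes; pose w := s.+1.
have hX : wt_ge w 2 (X - C a * sx) by apply: conj_X.
have ax1 : wt_ge w 1 (C a * sx) by apply: wt_geMl; apply: wt_ge_x.
have hX1 : wt_ge w 1 X.
  by rewrite -(subrK (C a * sx) X); apply: wt_geD => //; apply: wt_geW hX.
have hr : wt_ge w s.+1 (fps2_comp (fps2_of_x r') phi - C (r' s * a ^+ s) * sx ^+ s).
  have := fps2_comp_of_x (w := w) (n := s.+1) r' isT fp.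
  rewrite big_ord_recr /= big1 => [|k _]; last first.
    by rewrite rl' ?rmorph0 ?mul0r.
  have h2 := wt_geMl (C (r' s)) (wt_ge_subX s hX1 ax1 hX); rewrite muln1 in h2.
  move/wt_geD => /(_ _ h2); congr wt_ge.
  by rewrite add0r exprMn rmorphM rmorphXn /=; ring.
have hF : wt_ge w s.+1 (F - C (r s) * sx ^+ s).
  have := fps2_comp_of_x (w := w) (n := s.+1) r isT (fixes_origin_id R).
  rewrite fps2_comp_id big_ord_recr /= big1 => [|k _]; last first.
    by rewrite rl ?rmorph0 ?mul0r.
  move=> h; have := wt_geD (wt_ge_y w) h; congr wt_ge.
  by rewrite /F /map_id2 /=; ring.
have hdX : wt_ge w 1 (fps2_dx X - C a).
  have := wt_ge_dx hX; rewrite (cont_linearB _ _ (cl_dx R)) (clZ (cl_dx R)).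
  by rewrite dx_x mulr1.
have hFX : wt_ge w s.+1 (F * fps2_dx X - C (r s * a) * sx ^+ s).
  have h1 := wt_geMr (C a) hF.
  have hF1 : wt_ge w s F.
    rewrite -(subrK (C (r s) * sx ^+ s) F); apply: wt_geD; first exact: wt_geW hF.
    by apply: wt_geMl; apply: wt_geW (wt_geX s (wt_ge_x w)); rewrite muln1.
  have h2 := wt_geM hF1 hdX; rewrite addn1 in h2.
  have := wt_geD h2 h1; congr wt_ge; rewrite rmorphM /=; ring.
have := wt_ge_coef (wt_geB hFX hr) (_ : s + w * 0 < s.+1)%N.
rewrite muln0 addn0 => /(_ (ltnSn _)).
have Ys : Y s 0%N = 0 by case: s s0 {w rl rl' hX ax1 hX1 hr hF hdX hFX} => // s _; apply: conj_Y.
have := congr1 (fun b : fps2 R => b s 0%N) conj_residual.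
rewrite /residual -/X -/Y !coefB2 Ys subr0 !coefC2 coef02 => /subr0_eq ->.
rewrite -[sx ^+ s]mulr1 coefXnM2 leqnn subnn coef12 !mulr1.
by move=> /eqP; rewrite subr_eq0 => /eqP /addrI /oppr_inj.
Qed.

Section SameOrder.
Variable s : nat.
Hypotheses (s_gt1 : (1 < s)%N) (rs : r s != 0).
Hypotheses (rl : forall k, (k < s)%N -> r k = 0)
  (rl' : forall k, (k < s)%N -> r' k = 0).

Let D := X - C a * sx.

Lemma conj_c : r s = r' s * a ^+ s.-1.
Proof.
apply: (mulIf conj_a_neq0); rewrite -mulrA -exprSr prednK ?(ltnW s_gt1) //.
by apply: conj_lead => //; apply: ltnW.
Qed.

Lemma coef_homological n (c : R) (G : fps2 R) i j : homological n c G i j =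
  (if j is j'.+1 then fps2_dx G i j' else 0) +
  c * (if (n <= i)%N then fps2_dx G (i - n)%N j else 0) -
  (c * if (n.-1 <= i)%N then G (i - n.-1)%N j else 0) *+ n.
Proof.
rewrite /homological mulrDl coefB2 coefD2 coefYM2 coefMn2 -!mulrA !coefC2.
by rewrite !coefXnM2.
Qed.

(** Linearization between (a x, Y), whose residual is explicit, and the conjugacy
    itself, whose residual vanishes. *)
Lemma conj_linearized m d : (s < m)%N -> (d + s = m.+1)%N -> (1 < d)%N ->
  wt_ge s d D -> wt_ge s m.+1 (F * C a - Y - fps2_of_x (fun k => r' k * a ^+ k) +
                             homological s (r s) D).
Proof.
move=> sm ds d2 hD; have [X0 Y0] := conj_fixes.
have fp : fixes_origin (C a * sx, Y) by split; rewrite //= coefC2 mulr0.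
have fp' : fixes_origin (X, Y) by split.
have s0m : (0 < s < m)%N by lia.
have hF : wt_ge s s.+1 (F - (sy + C (r s) * sx ^+ s)).
  have := fps2_comp_of_x (w := s) (n := s.+1) r (ltnW s_gt1) (fixes_origin_id R).
  rewrite fps2_comp_id big_ord_recr /= big1 => [|k _]; last first.
    by rewrite rl ?rmorph0 ?mul0r.
  by congr wt_ge; rewrite /F; ring.
have h0 : wt_ge s 2 (C a * sx - C a * sx) by rewrite subrr; apply: wt_ge0.
have := residual_linearize s0m ds d2 hF conj_c rl' erefl (fun j _ => erefl)
  fp fp' h0 hD.
have -> : residual F (X, Y) r' = 0.
  by rewrite -conj_residual /X /Y; case: phi.
rewrite /residual /= (fps2_comp_of_x_scale _ fp erefl) (clZ (cl_dx R)) dx_x mulr1.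
rewrite !subrr mul0r rmorph0 mul0r !subr0 sub0r -opprD => /wt_geN.
by rewrite opprK.
Qed.

(** The coefficient of x^(n-1) y of the linearized equation isolates the
    coefficient of x^n in D. *)
Lemma conj_D_wt_ge n : (1 < n <= s)%N -> wt_ge s n D.
Proof.
elim: n => // n IH /andP[]; rewrite ltnS leq_eqVlt => /predU1P[<-|n1] ns.
  exact: conj_X.
have hD : wt_ge s n D by apply: IH; lia.
case: n {IH} n1 ns hD => [|[|k]] // _ ks hD.
have e1 : (s < k.+2 + s.-1)%N by lia.
have e2 : (k.+2 + s = (k.+2 + s.-1).+1)%N by lia.
have h := conj_linearized e1 e2 isT hD.
have := wt_ge_coef h (_ : k.+1 + s * 1 < _)%N; rewrite coefD2 coef_homological.
have -> : (s <= k.+1)%N = false by lia.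
have -> : (s.-1 <= k.+1)%N = false by lia.
rewrite !coefB2 conj_Y [F * _]mulrC coefC2 /F coefD2 /fps2_of_x /fps2_y /=.
rewrite !mulr0 mul0rn !addr0 !subr0 mulr0 add0r => /(_ _)/eqP.
rewrite /fps2_dx mulrn_eq0 /= => hk.
have Dk : D k.+2 0%N = 0 by apply/eqP/hk; lia.
move=> i j lt; have [lt'|ge] := ltnP (i + s * j) k.+2; first exact: hD.
have j0 : j = 0%N by case: j lt ge => // j; rewrite mulnS; lia.
have -> : i = k.+2 by move: lt ge; rewrite j0 muln0; lia.
by rewrite j0.
Qed.

Lemma conj_coef j : (s < j < s.*2)%N -> a * r j = r' j * a ^+ j.
Proof.
move=> /andP[sj js2]; have hD : wt_ge s s D by apply: conj_D_wt_ge; lia.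
have e1 : (s < s + s.-1)%N by lia.
have e2 : (s + s = (s + s.-1).+1)%N by lia.
have h := conj_linearized e1 e2 s_gt1 hD.
have := wt_ge_coef h (_ : j + s * 0 < _)%N; rewrite coefD2 coef_homological.
have -> : (s <= j)%N by lia.
have -> : (s.-1 <= j)%N by lia.
have Yj : Y j 0%N = 0 by case: j sj {js2} => // j _; apply: conj_Y.
rewrite !coefB2 Yj [F * _]mulrC coefC2 /F coefD2 /fps2_of_x /fps2_y /= andbF.
have ej : (j - s.-1 = (j - s).+1)%N by lia.
rewrite ej !add0r subr0 /fps2_dx mulrnAr.
(* The subscript j - s + 1 is at most s, with equality only for j = 2 s - 1; there
   the two terms have the same factor s, and elsewhere D vanishes. *)
have hres : r s * D (j - s).+1 0%N *+ (j - s).+1 = r s * D (j - s).+1 0%N *+ s.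
  have [lt|ge] := ltnP (j - s).+1 s; last by congr (_ *+ _); lia.
  by rewrite (wt_ge_coef hD) ?mulr0 ?mul0rn // muln0 addn0.
rewrite hres subrr addr0 => e; apply: subr0_eq; apply: e; lia.
Qed.

End SameOrder.
End Conjugacy.
End Uniqueness.

(** * Real normal forms *)
Section RealNormalForm.
Variable R : realType.
Implicit Types (r : nat -> R) (F : fps2 R) (v : fpair R).
Local Notation sx := (fps2_x R).
Local Notation sy := (fps2_y R).
Local Notation C := (@fps2_const R).

Lemma root_exists n (x : R) : (0 < n)%N -> 0 < x ->
  exists2 y : R, 0 < y & y ^+ n = x.
Proof.
move=> n0 x0; exists (x `^ n%:R^-1); first exact: powR_gt0.
rewrite -powR_mulrn ?powR_ge0 // -powRrM mulVf ?powRr1 ?ltW //.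
by rewrite pnatr_eq0 -lt0n.
Qed.

(** The scaling x -> a x, y -> a y multiplies the leading coefficient of the
    field by a power of exponent s - 1, here [n]; its parity decides whether the
    sign can be absorbed. *)
Lemma leading_scale n (c : R) : (0 < n)%N -> c != 0 -> exists eps a : R,
  [/\ eps = 1 \/ (~~ odd n /\ eps = -1), a != 0 & c = eps * a ^+ n].
Proof.
move=> n0 c0; have cn : 0 < `|c| by rewrite normr_gt0.
have [y y0 ey] := root_exists n0 cn.
have [cpos|cneg|/eqP] := ltgtP 0 c; last by rewrite eq_sym (negbTE c0).
  exists 1, y; split; [by left | by rewrite gt_eqF|].
  by rewrite mul1r ey ?gtr0_norm.
have {}ey : y ^+ n = - c by rewrite ey ?ltr0_norm.
have [on|en] := boolP (odd n).
  exists 1, (- y); split; [by left | by rewrite oppr_eq0 gt_eqF|].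
  by rewrite mul1r exprNn -signr_odd on expr1 mulN1r ey opprK.
exists (-1), y; split; [by right | by rewrite gt_eqF|].
by rewrite ey mulN1r opprK.
Qed.

Definition sign_normalized (s : nat) r : Prop :=
  odd s -> forall j, (s < j < s.*2)%N -> ~~ odd j -> r j != 0 ->
  (forall i, (s < i < j)%N -> ~~ odd i -> r i = 0) -> 0 < r j.

(** The effect on r of the rotation (x, y) -> (-x, -y). *)
Definition flip r : nat -> R := fun j => (-1) ^+ j.+1 * r j.

Lemma transforms_flip r :
  exists phi, transforms phi (normal_field r) (normal_field (flip r)).
Proof.
exists (C (-1) * sx, C (-1) * sy).
have hp : near_homothety (-1 : R) (C (-1) * sx, C (-1) * sy).
  by split; rewrite subrr; apply: wt_ge0.
have fp := near_homothety_fixes hp.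
have N1 : (-1) * (-1) = 1 :> R by rewrite mulrNN mulr1.
apply: (near_homothety_transforms N1 hp); last first.
  rewrite (clZ (cl_lie _)) lie_y /= -[fps2_const 0]/(0 : fps2 R) mulr0.
  by rewrite (cont_linear0 (cl_fps2_comp fp)).
rewrite (clZ (cl_lie _)) lie_x.
have nfE q : (normal_field q).1 = sy + fps2_of_x q by [].
rewrite !nfE.
rewrite (clD (cl_fps2_comp fp)) fps2_comp_y //= mulrDr; congr (_ + _).
rewrite (fps2_comp_of_x_scale _ fp erefl).
apply: fps2P => i j; rewrite coefC2 /fps2_of_x /flip; case: eqP => _; last by rewrite mulr0.
by rewrite mulrAC -exprD addSn exprS addnn -mul2n exprM sqrrN expr1n expr1n mulr1.
Qed.

Lemma flip_even r j : ~~ odd j -> flip r j = - r j.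
Proof. by move=> ej; rewrite /flip -signr_odd /= ej expr1 mulN1r. Qed.

(** Only the first non-zero coefficient of even degree matters, and the flip
    changes its sign. *)
Lemma sign_normalized_or_flip s r :
  sign_normalized s r \/ odd s /\ sign_normalized s (flip r).
Proof.
apply: contrapT => /not_orP[h nh]; apply: h => os j hj ej nz hmin.
have [//|rj|e] := ltgtP 0 (r j); last by rewrite -e eqxx in nz.
exfalso; apply: nh; split=> // _ j' hj' ej' nz' hmin'.
rewrite flip_even // in nz' *; have [lt|gt|->] := ltngtP j' j.
- by rewrite hmin ?oppr0 ?eqxx // in nz'; lia.
- have := hmin' j; rewrite flip_even // => /(_ _ ej)/eqP.
  by rewrite oppr_eq0 (negbTE nz) => /(_ _)/negP[] //; lia.
- by rewrite oppr_gt0.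
Qed.

Lemma normal_series_of_data s (a eps : R) X b r : (1 < s)%N ->
  eps = 1 \/ (odd s /\ eps = -1) -> normal_data s a eps X b r ->
  exists phi r', transforms phi (normal_field r) (normal_field r') /\
    normal_series r'.
Proof.
move=> s1 heps [_ _ _ _ rl rs rm].
have [hs|[os hs]] := sign_normalized_or_flip s r.
  exists (map_id2 R), r; split; last first.
    by right; exists s, eps; split.
  exists (map_id2 R).
    by split; rewrite ?map_comp2_idr; try exact: fixes_origin_id.
  rewrite /Defs.pushforward /map_comp2 !fps2_comp_id lie_x lie_y.
  by case: (normal_field r).
have [phi hphi] := transforms_flip r; exists phi, (flip r); split=> //.
right; exists s, eps; split=> //.
- by move=> j js; rewrite /flip rl ?mulr0.
- by rewrite /flip -signr_odd /= os expr0 mul1r.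
- by move=> j js dv; rewrite /flip rm ?mulr0.
Qed.

Lemma transforms_to_normal_form F : wt_ge 1 2 (F - sy) ->
  exists phi r, transforms phi (F, 0) (normal_field r) /\ normal_series r.
Proof.
move=> hF; have [F0|/existsNP[n /eqP Fn]] := pselect (forall i, F i 0%N = 0).
  have [phi h] := transforms_to_zero hF F0.
  by exists phi, (fun=> 0); split=> //; left.
have ex : exists n, F n 0%N != 0 by exists n.
case: (ex_minnP ex) => s Fs smin {n Fn ex}.
have Flow i : (i < s)%N -> F i 0%N = 0.
  by move=> lt; apply/eqP; apply: contraTT lt => /smin; rewrite -leqNgt.
have s1 : (1 < s)%N.
  rewrite ltnNge; apply: contraNN Fs => le; have := wt_ge_coef hF (_ : s + 1 * 0 < 2)%N.
  rewrite coefB2 /fps2_y /= andbF subr0 => ->; rewrite ?eqxx //; lia.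
have s0 : (0 < s.-1)%N by lia.
have [eps [a [heps a0 ec]]] := leading_scale s0 Fs.
have heps' : eps = 1 \/ (odd s /\ eps = -1).
  case: heps => [->|[os ->]]; [by left|right; split=> //].
  by move: os; rewrite -[in odd s](prednK (ltnW s1)) /=.
have hFs : wt_ge s s.+1 (F - (sy + C (F s 0%N) * sx ^+ s)).
  move=> i j lt; rewrite coefB2 coefD2 coefC2 -[sx ^+ s]mulr1 coefXnM2 coef12.
  case: j lt => [|[|j]] lt.
  - rewrite /fps2_y andbF add0r muln0 addn0 ltnS in lt *.
    case: ltngtP lt => // [lt|->] _; first by rewrite Flow // mulr0 subrr.
    by rewrite subnn eqxx mulr1 subrr.
  - have -> : i = 0%N by lia.
    have := wt_ge_coef hF (_ : 0 + 1 * 1 < 2)%N; rewrite coefB2 => /(_ isT)/subr0_eq ->.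
    by case: ifP; rewrite ?andbF ?mulr0 ?addr0 subrr.
  - by exfalso; rewrite !mulnS in lt; lia.
have [X [b [r [nd res]]]] := normalization_exists s1 a0 Fs hFs ec.
have [phi [r' [hphi hr']]] := normal_series_of_data s1 heps' nd.
exists (map_comp2 phi (X, of_y b)), r'; split=> //.
apply: transforms_trans hphi; case: nd => hX X0 b0 b1 _ _ _.
apply: (@residual_transforms _ a a^-1) => //; first by rewrite mulVf.
  split=> i j; rewrite mul1n => lt /=.
    have [j0|j0] := posnP j.
      by apply: (wt_ge_coef hX); rewrite j0 muln0; lia.
    have -> : i = 0%N by lia.
    by rewrite coefB2 coefC2 X0 /fps2_x /= mulr0 subrr.
  rewrite coefB2 coefC2 /of_y /fps2_y.
  case: i lt => [|i] /=; last by rewrite mulr0 subrr.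
  by case: j => [|[|j]] // _; rewrite ?b0 ?b1 ?mulr0 ?mulr1 subrr.
by apply: fps2P => i j; rewrite /fps2_dx /= mul0rn coef02.
Qed.

Lemma odd_root_unity n (a : R) : odd n -> a ^+ n = 1 -> a = 1.
Proof.
move=> on e; have a0 : 0 <= a.
  by rewrite leNgt -(exprn_odd_lt0 _ on) e ltr10.
by apply/eqP; rewrite -(@pexpr_eq1 _ _ n) ?e //; case: n on {e}.
Qed.

Lemma even_root_unity n (a : R) : (0 < n)%N -> ~~ odd n -> a ^+ n = 1 ->
  a = 1 \/ a = -1.
Proof.
move=> n0 en e; have e1 : `|a| = 1.
  apply/eqP; rewrite -(@pexpr_eq1 _ _ n) // -normrX e normr1 //.
have /eqP := e1; rewrite eqr_norml ler01 andbT => /orP[]/eqP; [by left|by right].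
Qed.

(** The relation a r_j = a^j r'_j settles everything when a = 1. When a = -1 it says
    that r' is the flip of r in the range; a first non-zero even coefficient
    would then be positive for both and opposite in sign, so there is none. *)
Lemma normal_form_invariant phi r r' s (eps : R) :
  transforms phi (normal_field r) (normal_field r') ->
  normal_type s eps r -> normal_series r' ->
  normal_type s eps r' /\ forall j, (s < j < s.*2)%N -> r' j = r j.
Proof.
move=> hphi nt hr'; have [s1 heps rl rs rm rsgn] := nt.
have [r0 r1] : r 0%N = 0 /\ r 1%N = 0 by split; apply: rl; lia.
pose a := phi.1 1%N 0%N; have a0 : a != 0 := conj_a_neq0 hphi r0 r1.
have eps0 (e : R) n : e = 1 \/ (odd n /\ e = -1) -> e != 0.
  by case=> [->|[_ ->]]; rewrite ?oppr_eq0 oner_eq0.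
have lead := conj_lead hphi r0 r1.
have epsa : eps * a != 0 by rewrite mulf_neq0 // (eps0 _ _ heps).
(* The leading relation excludes that r' starts later than r, or is zero; used at
   the order of r', it excludes that r' starts earlier. *)
have nz : ~ (forall k, (k <= s)%N -> r' k = 0).
  move=> h; have := lead s (ltnW s1) rl (fun k lt => h k (ltnW lt)).
  by rewrite rs h // mul0r => /eqP; rewrite (negbTE epsa).
case: hr' => [z|[s' [eps' nt']]]; first by case: nz => k _; apply: z.
have [s1' heps' rl' rs' rm' rsgn'] := nt'.
have es : s' = s.
  case: (ltngtP s' s) => // [lt|gt].
    have := lead s' (ltnW s1') (fun k h => rl k (ltn_trans h lt)) rl'.
    rewrite rl // mul0r rs' => /esym/eqP.
    by rewrite mulf_eq0 (negbTE (eps0 _ _ heps')) expf_eq0 (negbTE a0) andbF.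
  by case: nz => k le; apply: rl'; apply: leq_ltn_trans le gt.
rewrite es in nt' s1' heps' rl' rs' rm' rsgn' *.
have rs0 : r s != 0 by rewrite rs; apply: eps0 heps.
have ec : eps = eps' * a ^+ s.-1.
  by rewrite -rs -rs'; apply: (conj_c hphi r0 r1 s1).
have co j : (s < j < s.*2)%N -> a * r j = r' j * a ^+ j.
  exact: (conj_coef hphi r0 r1 s1).
have [os|es'] := boolP (odd s); last first.
  have e1 : eps = 1 by case: heps => // [[os _]]; rewrite os in es'.
  have e1' : eps' = 1 by case: heps' => // [[os _]]; rewrite os in es'.
  have a1 : a = 1.
    apply: (@odd_root_unity s.-1); last by rewrite ec e1' mul1r in e1.
    by move: es'; rewrite -[in odd s](prednK (ltnW s1)) /= negbK.
  rewrite e1 -e1'; split=> // j hj.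
  by have := co j hj; rewrite a1 expr1n mul1r mulr1.
have ev : ~~ odd s.-1 by move: os; rewrite -[in odd s](prednK (ltnW s1)).
have pos : 0 <= a ^+ s.-1 by apply: exprn_even_ge0.
have ee : eps' = eps.
  apply/eqP; move: ec pos a0.
  case: heps => [->|[_ ->]]; case: heps' => [->|[_ ->]] //.
    rewrite mulN1r => e; have -> : a ^+ s.-1 = -1 by rewrite e opprK.
    by rewrite oppr_ge0 ler10.
  by rewrite mul1r => <-; rewrite oppr_ge0 ler10.
rewrite ee in nt' ec *; split=> //.
have ua : a ^+ s.-1 = 1.
  apply: (mulfI (eps0 _ _ heps)); by rewrite -ec mulr1.
have s0 : (0 < s.-1)%N by lia.
have [a1|am1] := even_root_unity s0 ev ua.
  by move=> j hj; have := co j hj; rewrite a1 expr1n mul1r mulr1.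
have flip_co j : (s < j < s.*2)%N -> r' j = flip r j.
  move=> hj; have e := co j hj; rewrite am1 in e.
  by rewrite /flip exprSr -mulrA e mulrCA -expr2 sqrr_sign mulr1.
have evz j : (s < j < s.*2)%N -> ~~ odd j -> r j = 0.
  elim/ltn_ind: j => j IH hj ej; apply: contrapT => /eqP nzj.
  have hmin i : (s < i < j)%N -> ~~ odd i -> r i = 0 by move=> hi; apply: IH; lia.
  have hmin' i : (s < i < j)%N -> ~~ odd i -> r' i = 0.
    by move=> hi ei; rewrite flip_co ?flip_even ?hmin ?oppr0 //; lia.
  have := rsgn os j hj ej nzj hmin.
  have rj' : r' j = - r j by rewrite flip_co // flip_even.
  have := rsgn' os j hj ej _ hmin'; rewrite rj' oppr_eq0 => /(_ nzj).
  by rewrite oppr_gt0 => /lt_trans h /h; rewrite ltxx.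
move=> j hj; have [oj|ej] := boolP (odd j).
  by rewrite flip_co // /flip -signr_odd /= oj expr0 mul1r.
by rewrite flip_co // flip_even // evz // oppr0.
Qed.

End RealNormalForm.

Theorem theorem1p2 (R : realType) (f g : fps2 R)
    (f_conv : convergent f) (g_conv : convergent g)
    (f_ord : order_ge 2 f) (g_ord : order_ge 2 g)
    (v_int : exists H : fps2 R,
       nonsingular_formal_integral (nilpotent_field f g) H) :
  (exists r : nat -> R, normal_form_of (nilpotent_field f g) r) /\
  (forall (r r' : nat -> R) (sigma : nat) (eps : R),
     normal_form_of (nilpotent_field f g) r ->
     normal_form_of (nilpotent_field f g) r' ->
     normal_type sigma eps r ->
     normal_type sigma eps r' /\
     forall j : nat, (sigma < j < sigma.*2)%N -> r' j = r j).
Proof.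
split.
  have [H hH] := v_int.
  have [phi0 [F [h0 hF]]] := straighten_integral f_ord g_ord hH.
  have [phi1 [r [h1 hr]]] := transforms_to_normal_form hF.
  have h := transforms_trans h0 h1.
  exists r; split=> //; exists (map_comp2 phi1 phi0) => //.
  exact: transforms_formal_transformation h.
move=> r r' sigma eps [_ [phi _ h]] [hr' [phi' _ h']] nt.
have [psi hpsi] := transforms_sym h.
exact: normal_form_invariant (transforms_trans hpsi h') nt hr'.
Qed.
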